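(* Let $M=\mathbb{T}^3_A$ be the hyperbolic torus attached to a matrix $A\in\mathrm{SL}(2,\mathbb{Z})$ with $\mathrm{tr}(A)>2$ and irrational eigenvalue $\lambda$, let $X$ be the vector field on $M$ induced by $\lambda^t\left(\frac{\partial}{\partial x}+a\frac{\partial}{\partial y}\right)$, where $(1,a)$ is an eigenvector of $A$ for $\lambda$, and let $\rho:\mathbb{Z}\to\mathrm{Diff}(M)$, $\rho(n)=\phi_n^X$, be the discrete flow of $X$. Let $\mathcal{C}_\tau(M)$ be the complex of divergence forms of $X$ and $\Omega(M)_\rho$ the complex of $\rho$-co-invariant forms. Then the homomorphism $$I:\mathcal{C}_\tau(M)\longrightarrow\Omega(M)_\rho,\qquad I(\eta)=\int_{[0,1]}\phi^*\eta\wedge\mathrm{pr}_2^*(ds),$$ where the integral denotes integration along the fibers of $\mathrm{pr}_1:M\times[0,1]\to M$ and $\phi:M\times[0,1]\to M$ is the restricted flow of $X$, is an isomorphism.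
   Context: Hyperbolic torus: let $A\in\mathrm{SL}(2,\mathbb{Z})$ with $\mathrm{tr}(A)>2$. Then $A=PDP^{-1}$ with $P\in\mathrm{GL}(2,\mathbb{R})$, $D=\mathrm{diag}(\lambda,\lambda^{-1})$, $\lambda>0$, $\lambda\neq1$. For $t\in\mathbb{R}$ put $D^t=\mathrm{diag}(\lambda^t,\lambda^{-t})$ and $A^t=PD^tP^{-1}$. Let $G_3=\mathbb{R}^2\rtimes\mathbb{R}$ be the semidirect product for the homomorphism $\mathbb{R}\to\mathrm{Aut}(\mathbb{R}^2)$, $t\mapsto A^t$, i.e. $(u,t)(u',t')=(u+A^tu',t+t')$, and let $\Gamma_3=\mathbb{Z}^2\rtimes\mathbb{Z}\subset G_3$. Then $\mathbb{T}^3_A:=\Gamma_3\backslash G_3$, a compact smooth $3$-manifold. The eigenvalue $\lambda$ is assumed irrational. With $(x,y,t)$ the coordinates on $G_3=\mathbb{R}^2\times\mathbb{R}$, the vector field $\lambda^t\left(\frac{\partial}{\partial x}+a\frac{\partial}{\partial y}\right)$ is left invariant on $G_3$ and hence descends to $\mathbb{T}^3_A$. Its flow is denoted $\phi^X_s$, $s\in\mathbb{R}$, and $\phi(m,s)=\phi^X_s(m)$ for $(m,s)\in M\times[0,1]$. Co-invariant forms: $\Omega^p(M)_\rho:=\mathrm{span}\{\omega-\rho(n)^*\omega : n\in\mathbb{Z},\ \omega\in\Omega^p(M)\}$ (which equals $\{\omega-(\phi_1^X)^*\omega:\omega\in\Omega^p(M)\}$) and $\Omega(M)_\rho=\bigoplus_p\Omega^p(M)_\rho$,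 a subcomplex of the de Rham complex $\Omega(M)$. Divergence forms: $\mathcal{C}^p_\tau(M):=\{L_X\omega:\omega\in\Omega^p(M)\}$ and $\mathcal{C}_\tau(M)=\bigoplus_p\mathcal{C}^p_\tau(M)$, a subcomplex of the de Rham complex; here $\tau:\mathbb{R}\to\{\text{vector fields on }M\}$ is the Lie algebra homomorphism with $\tau(1)=X$. The operator $I$: $\mathrm{pr}_1,\mathrm{pr}_2$ are the projections of $M\times[0,1]$ and $ds$ is the standard volume form on $[0,1]$. Fiber integration $\int_{[0,1]}:\Omega^*(M\times[0,1])\to\Omega^{*-1}(M)$ is normalized by the Stokes formula $\int_{[0,1]}d\Omega=-d\int_{[0,1]}\Omega+\iota_1^*\Omega-\iota_0^*\Omega$, with $\iota_s(m)=(m,s)$; explicitly $\int_{[0,1]}\Omega=\int_0^1\iota_s^*(i_{\partial/\partial s}\Omega)\,ds$. $I$ preserves degree, satisfies $I\circ d=-d\circ I$ on $\Omega(M)$ (this is the sense in which it is a homomorphism of complexes), and maps $\mathcal{C}_\tau(M)$ into $\Omega(M)_\rho$. *)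

(* Defs.v *)
From mathcomp Require Import all_boot all_order all_algebra perm.
From mathcomp Require Import all_classical all_reals all_analysis.

Set Implicit Arguments.
Unset Strict Implicit.
Unset Printing Implicit Defensive.

Import Order.TTheory GRing.Theory Num.Theory.
Import numFieldNormedType.Exports.

Local Open Scope classical_set_scope.
Local Open Scope ring_scope.

(** ** Differential forms on a finite-dimensional normed space *)

(* [f] is of class C^k: differentiable with directional derivatives of class
   C^(k-1).  This is the usual notion only because it is used on spaces of
   finite dimension. *)
Fixpoint Ck (R : realType) (E : normedModType R) (k : nat) (f : E -> R) : Prop :=
  match k with
  | 0 => continuous f
  | k'.+1 => (forall x, differentiable f x) /\
             (forall v, Ck k' (fun x => 'D_v f x))
  end.

Definition smooth (R : realType) (E : normedModType R) (f : E -> R) : Prop :=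
  forall k, Ck k f.

(* Every tangent space of [E] is identified with [E].  A term of [dform E p] is
   an arbitrary function of a point and [p] tangent vectors; alternation,
   multilinearity and smoothness are imposed by [is_form]. *)
Definition dform (R : realType) (E : normedModType R) (p : nat) : Type :=
  E -> ('I_p -> E) -> R.

Definition multilinear (R : realType) (E : normedModType R) (p : nat)
    (f : ('I_p -> E) -> R) : Prop :=
  forall (v : 'I_p -> E) (i : 'I_p) (c : R) (u w : E),
    f (dfwith v i (c *: u + w)) = c * f (dfwith v i u) + f (dfwith v i w).

Definition alternating (R : realType) (E : normedModType R) (p : nat)
    (f : ('I_p -> E) -> R) : Prop :=
  forall (v : 'I_p -> E) (i j : 'I_p), i != j -> v i = v j -> f v = 0.

Definition is_form (R : realType) (E : normedModType R) (p : nat)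
    (w : dform E p) : Prop :=
  [/\ forall x, multilinear (w x), forall x, alternating (w x)
    & forall v, smooth (fun x => w x v)].

Definition pullback (R : realType) (E F : normedModType R) (p : nat)
    (f : E -> F) (w : dform F p) : dform E p :=
  fun x v => w (f x) (fun i => 'd f x (v i)).

Definition form_cast (R : realType) (E : normedModType R) (p q : nat)
    (e : p = q) (w : dform E p) : dform E q :=
  fun x v => w x (fun i => v (cast_ord e i)).

(* dw(v_0,...,v_p) = sum_i (-1)^i v_i . w(v_0,...,^v_i,...,v_p), the [v_i] being
   extended to constant vector fields, whose brackets vanish. *)
Definition exterior_d (R : realType) (E : normedModType R) (p : nat)
    (w : dform E p) : dform E p.+1 :=
  fun x v => \sum_(i < p.+1)
    (-1) ^+ i * 'D_(v i) (fun y => w y (fun j => v (lift i j))) x.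

(* Normalized so that (dx /\ dy)(e_x, e_y) = 1. *)
Definition wedge_form (R : realType) (E : normedModType R) (p q : nat)
    (w : dform E p) (h : dform E q) : dform E (p + q) :=
  fun x v => (p`! * q`!)%:R^-1 * \sum_(s : 'S_(p + q)) (-1) ^+ s *
    (w x (fun i => v (s (lshift q i))) * h x (fun j => v (s (rshift p j)))).

(* X is inserted in the first slot. *)
Definition contraction (R : realType) (E : normedModType R) (p : nat)
    (X : E -> E) (w : dform E p.+1) : dform E p :=
  fun x v => w x (fun i => oapp v (X x) (unlift ord0 i)).

(** ** Flows and Lie derivatives *)

Definition is_flow (R : realType) (E : normedModType R)
    (X : E -> E) (phi : R -> E -> E) : Prop :=
  (forall x, phi 0 x = x) /\
  (forall x (s : R), is_derive s 1 (fun r : R => phi r x) (X (phi s x))).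

(* The Lie derivative along the vector field with flow [phi]. *)
Definition lie_derivative (R : realType) (E : normedModType R) (p : nat)
    (phi : R -> E -> E) (w : dform E p) : dform E p :=
  fun x v => derive1 (fun s : R => pullback (phi s) w x v) 0.

(** ** Integration along the fibres of [N * [0, 1] -> N] *)

(* Forms on [E * [0, 1]] are written as forms on [E * R]; only their values at
   points of [E * [0, 1]] are used. *)
Definition fiber_integral (R : realType) (E : normedModType R) (p : nat)
    (W : dform (E * R)%type p.+1) : dform E p :=
  fun x v => \int[@lebesgue_measure R]_(s in `[0, 1])
    pullback (fun m : E => (m, s : R) : E * R)
      (contraction (fun=> (0, 1) : E * R) W) x v.

(* The form ds on R. *)
Definition volume_form (R : realType) : dform R 1 := fun _ v => v ord0.

(* I(eta) = int_[0,1] phi^* eta /\ pr_2^* ds. *)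
Definition flow_integral (R : realType) (E : normedModType R) (p : nat)
    (phi : R -> E -> E) (eta : dform E p) : dform E p :=
  fiber_integral (form_cast (addn1 p)
    (wedge_form (pullback (fun z : E * R => phi z.2 z.1) eta)
           (pullback (fun z : E * R => z.2) (@volume_form R)))).

(** ** Complexes of forms *)

Definition lspan (R : realType) (V : lmodType R) (S : set V) : set V :=
  [set x | exists n (c : 'I_n -> R) (f : 'I_n -> V),
     (forall i, S (f i)) /\ x = \sum_(i < n) c i *: f i].

(* A graded space of forms is given by its homogeneous components. *)
Definition graded (R : realType) (E : normedModType R) : Type :=
  forall p, set (dform E p).

Definition d_closed (R : realType) (E : normedModType R) (C : graded E) : Prop :=
  forall p w, C p w -> C p.+1 (exterior_d w).

(* Degree-preserving isomorphism [f : C -> D] of complexes, with the convention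
   [f d = - d f]. *)
Definition anti_complex_iso (R : realType) (E : normedModType R)
    (C D : graded E) (f : forall p, dform E p -> dform E p) : Prop :=
  [/\ d_closed C, d_closed D,
      forall p (c : R) (w h : dform E p), C p w -> C p h ->
        f p (c *: w + h) = c *: f p w + f p h,
      forall p (w : dform E p), C p w ->
        f p.+1 (exterior_d w) = - exterior_d (f p w)
    & forall p, set_bij (C p) (D p) (f p)].

Definition divergence_forms (R : realType) (E : normedModType R)
    (Omega : graded E) (phi : R -> E -> E) : graded E :=
  fun p => [set lie_derivative phi w | w in Omega p].

Definition coinvariant_forms (R : realType) (E : normedModType R)
    (Omega : graded E) (rho : int -> E -> E) : graded E :=
  fun p => lspan [set h | exists n w, Omega p w /\ h = w - pullback (rho n) w].

(** ** The hyperbolic torus *)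

Definition vec2 (R : realType) (x y : R) : 'cV[R]_2 :=
  \col_i (if i == ord0 then x else y).

Definition diag2 (R : realType) (x y : R) : 'M[R]_2 :=
  diag_mx (\row_i (if i == ord0 then x else y)).

(* A^t = P D^t P^-1, where D = diag(lam, lam^-1). *)
Definition mxpow (R : realType) (P : 'M[R]_2) (lam t : R) : 'M[R]_2 :=
  P *m diag2 (lam `^ t) (lam `^ (- t)) *m invmx P.

Definition G3 (R : realType) : normedModType R := ('cV[R]_2 * R)%type.

Definition G3_mul (R : realType) (P : 'M[R]_2) (lam : R) (g h : G3 R) : G3 R :=
  (g.1 + mxpow P lam g.2 *m h.1, g.2 + h.2).

Definition Gamma3 (R : realType) : set (G3 R) :=
  [set ((map_mx intr u.1 : 'cV[R]_2), (u.2%:~R : R)) | u in [set: 'cV[int]_2 * int]].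

(* The p-forms on the quotient of G_3 by left translations by Gamma_3, each
   given by its pullback to G_3.  The projection being a covering whose deck
   transformations are these translations, the pullbacks are exactly the
   Gamma_3-invariant forms; d, Lie derivatives along a left invariant field,
   pullback by its flow, and fibre integration commute with this pullback. *)
Definition torus_forms (R : realType) (P : 'M[R]_2) (lam : R) : graded (G3 R) :=
  fun p => [set w | is_form w /\
    forall g, Gamma3 g -> pullback (G3_mul P lam g) w = w].

(* lam^t (d/dx + a d/dy) *)
Definition torus_field (R : realType) (lam a : R) (g : G3 R) : G3 R :=
  (lam `^ g.2 *: vec2 1 a, 0).

(* Main.v *)
Require Import Defs.
From mathcomp Require Import all_boot all_order all_algebra.
From mathcomp Require Import perm.
From mathcomp Require Import all_classical all_reals all_analysis.
From mathcomp Require Import ring lra.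

(** Write [phi_s] for the flow, [w] for an invariant form and [I] for the fibre
    integral. In the coordinates [(u, t)] of the group the flow is
    [phi_s (u, t) = (u + s lam^t e, t)] with [e = (1, a)], which is read off from
    the differential equation since [t] is constant along it ([torus_flowE]).

    On a Lie derivative the integrand of [I] is, up to the sign [(-1)^p], the time
    derivative of the pullback [phi_s^* w]; so
    [I (L_X w) = (-1)^p (phi_1^* w - w)] by the fundamental theorem of calculus
    ([flow_integral_lie_derivative_shear]). The coinvariant forms are exactly the
    differences [phi_1^* w - w], by telescoping ([coinvariant_formsP]), which gives
    surjectivity. Compatibility with [d] up to sign is then the naturality of [d]
    under the flow ([exterior_d_pullback_shear]) and its infinitesimal version
    ([exterior_d_lie_derivative_shear]), the sign coming from the change of degree
    in [(-1)^p].

    Injectivity says that [phi_1^* w = w] implies [L_X w = 0]. In fact such a form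
    is fixed by the whole flow ([flow_invariant_form]). The differential of
    [phi_s] adds to a vector a multiple of [e] that is linear in [s], and an
    alternating form cannot have [e] in two slots; so, if [phi_1^* w = w], a
    coefficient of [w] along the orbit of [phi_1] is an affine function of [n]. It
    is also bounded, because on each fibre [t = constant] it is periodic under the
    integer translations; hence it is constant. A continuous function invariant
    under these translations and under [phi_1] only depends on [t]
    ([translation_invariant_fibrewise_constant]): on the fibres where [lam^t] is
    a rational number [m / n], the [n]-th iterate of [phi_1] translates [u] by
    [(m, m a)], that is, modulo integers, by an irrational amount in the second
    direction, and such fibres are dense; similarly where [lam^(t - 1)] is
    rational the first coordinate is translated by the irrational number
    [m lam]. So all coefficients are constant along the flow, and so are the
    pullbacks [phi_s^* w].

    The calculus is done for the flows [x + s exp(c tau x) e] of a normed space,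
    where [tau] is a continuous linear form vanishing on [e]; on the torus [tau] is
    the last coordinate and [c = ln lam]. *)

Set Implicit Arguments.
Unset Strict Implicit.
Unset Printing Implicit Defensive.

Import Order.TTheory GRing.Theory Num.Theory.
Import numFieldNormedType.Exports.

Local Open Scope classical_set_scope.
Local Open Scope ring_scope.

(** * Alternating multilinear forms *)

Section AlternatingAlgebra.
Context {R : realType} {E : normedModType R}.
Implicit Types (p : nat).

Lemma dfwith_id p (v : 'I_p -> E) i : dfwith v i (v i) = v.
Proof. by apply/funext => j; case: dfwithP. Qed.

Lemma dfwithC p (v : 'I_p -> E) i j x y : i != j ->
  dfwith (dfwith v i x) j y = dfwith (dfwith v j y) i x.
Proof.
move=> ij; apply/funext => k.
have [->|ki] := eqVneq k i; first by rewrite dfwithin dfwithout 1?eq_sym// dfwithin.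
have [->|kj] := eqVneq k j; first by rewrite dfwithin dfwithout// dfwithin.
by rewrite !dfwithout // eq_sym.
Qed.

Section OneForm.
Context {p : nat} (f : ('I_p -> E) -> R).
Hypotheses (mf : multilinear f) (af : Defs.alternating f).

Lemma multilinearD v i u w :
  f (dfwith v i (u + w)) = f (dfwith v i u) + f (dfwith v i w).
Proof. by have := mf v i 1 u w; rewrite scale1r mul1r. Qed.

Lemma alternating_swap v i j x y : i != j ->
  f (dfwith (dfwith v i x) j y) = - f (dfwith (dfwith v i y) j x).
Proof.
move=> ij; apply/eqP; rewrite -addr_eq0; apply/eqP.
have z u : f (dfwith (dfwith v i u) j u) = 0.
  by apply: (af ij); rewrite dfwithin dfwithout 1?eq_sym// dfwithin.
have := z (x + y).
by rewrite multilinearD !(dfwithC _ _ _ ij) !multilinearD -!(dfwithC _ _ _ ij)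
  !z add0r addr0 addrC.
Qed.

Lemma alternating_tperm v i j : i != j ->
  f (fun k => v (tperm i j k)) = - f v.
Proof.
move=> ij.
have -> : (fun k => v (tperm i j k)) = dfwith (dfwith v i (v j)) j (v i).
  apply/funext => k; case: tpermP => [->|->|/eqP ki /eqP kj].
  - by rewrite dfwithout 1?eq_sym// dfwithin.
  - by rewrite dfwithin.
  - by rewrite !dfwithout // eq_sym.
by rewrite alternating_swap// !dfwith_id.
Qed.

Lemma alternating_perm (s : 'S_p) v :
  f (fun k => v (s k)) = (-1) ^+ s * f v.
Proof.
have [ts -> dts] := prod_tpermP s.
elim: ts dts v => [|t ts IH] /=.
  move=> _ v; rewrite big_nil odd_perm1 mul1r; congr f.
  by apply/funext => k; rewrite perm1.
move=> /andP[dt dts] v; rewrite big_cons odd_mul_tperm dt addTb.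
under eq_fun do rewrite permM.
rewrite (alternating_tperm (fun k => v ((\prod_(t <- ts) tperm t.1 t.2)%g k)))//.
by rewrite (IH dts) signrN mulNr.
Qed.

(** A term with [e] in two slots vanishes by alternation, so the expansion stops
    at first order. This is what makes the pullback of a form by the flow affine
    in time, up to the displacement of the base point. *)
Lemma alternating_shear v (c : 'I_p -> R) e :
  f (fun j => v j + c j *: e) = f v + \sum_j c j * f (dfwith v j e).
Proof.
suff H k : (k <= p)%N -> forall v c, (forall j : 'I_p, (k <= j)%N -> c j = 0) ->
    f (fun j => v j + c j *: e) = f v + \sum_j c j * f (dfwith v j e).
  by apply: (H p) => // j; rewrite leqNgt ltn_ord.
elim: k => [_|k IH kp] {}v {}c c0.
  rewrite big1 ?addr0; last by move=> j _; rewrite c0// mul0r.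
  by congr f; apply/funext => j; rewrite c0// scale0r addr0.
pose K := Ordinal kp; pose c' j := if j == K then 0 else c j.
have c'0 (j : 'I_p) : (k <= j)%N -> c' j = 0.
  rewrite /c'; have [//|jK] := eqVneq j K => kj; apply: c0.
  by rewrite ltn_neqAle kj andbT; apply: contra jK => /eqP jK; apply/eqP/val_inj.
have -> : (fun j => v j + c j *: e) =
    dfwith (fun j => v j + c' j *: e) K (c K *: e + v K).
  apply/funext => j; have [->|jK] := eqVneq j K; first by rewrite dfwithin addrC.
  by rewrite dfwithout 1?eq_sym// /c' (negbTE jK).
rewrite mf.
have -> : dfwith (fun j => v j + c' j *: e) K (v K) = (fun j => v j + c' j *: e).
  have -> : v K = v K + c' K *: e by rewrite c'0// scale0r addr0.
  exact: dfwith_id.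
have -> : dfwith (fun j => v j + c' j *: e) K e =
   (fun j => dfwith v K e j + c' j *: e).
  apply/funext => j; have [->|jK] := eqVneq j K.
    by rewrite !dfwithin c'0// scale0r addr0.
  by rewrite !dfwithout // eq_sym.
rewrite !(IH (ltnW kp) _ _ c'0) [in RHS](bigD1 K)//=.
rewrite (bigD1 K)//= c'0// mul0r add0r big1 ?addr0; last first.
  move=> j jK; rewrite (@af _ j K)// ?mulr0// dfwithin dfwithout// ?dfwithin// eq_sym.
rewrite addrCA; congr (_ + (_ + _)).
rewrite (bigD1 K)//= c'0// mul0r add0r.
by apply: eq_bigr => j jK; rewrite /c' (negbTE jK).
Qed.

End OneForm.

(** Reduces a permutation to its action on the indices that remain when one
    index and its image are omitted; the exterior derivative and the wedge with
    a form of degree one are sums over such omissions. *)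
Lemma lift_perm_surj n (s : 'S_n.+1) i : exists t : 'S_n, s = lift_perm i (s i) t.
Proof.
pose g k := odflt k (unlift (s i) (s (lift i k))).
have gE k : lift (s i) (g k) = s (lift i k).
  rewrite /g; case: unliftP => [j -> //|/perm_inj /eqP].
  by rewrite eq_sym (negbTE (neq_lift _ _)).
have gI : injective g.
  by move=> k l /(congr1 (lift (s i))); rewrite !gE => /perm_inj/lift_inj.
exists (perm gI); apply/permP => k.
have [j ->|->] := unliftP i k; last by rewrite lift_perm_id.
by rewrite lift_perm_lift permE gE.
Qed.

(** Adding multiples of one argument to the others does not change the value of
    an alternating form; an argument outside the kernel of [tau] can thus be used
    to bring all the others into it. *)
Lemma eq_alternating_pivot p (f g : ('I_p.+1 -> E) -> R) (tau : {linear E -> R}) :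
  multilinear f -> Defs.alternating f -> multilinear g -> Defs.alternating g ->
  (forall v k, (forall j, j != k -> tau (v j) = 0) -> f v = g v) -> f = g.
Proof.
move=> mf af mg ag fg; apply/funext => v.
have [[k tk]|/forallNP t0] := pselect (exists k, tau (v k) != 0); last first.
  by apply: (fg v ord0) => j _; apply/eqP/negPn/negP/t0.
pose c j := if j == k then 0 else - (tau (v j) / tau (v k)).
have col h : multilinear h -> Defs.alternating h -> h v = h (fun j => v j + c j *: v k).
  move=> mh ah; rewrite (alternating_shear mh ah) big1 ?addr0// => j _.
  rewrite /c; case: eqVneq => [|jk]; first by rewrite mul0r.
  by rewrite (ah _ j k)// ?mulr0// dfwithin dfwithout.
rewrite (col _ mf af) (col _ mg ag); apply: (fg _ k) => j jk.
by rewrite linearD linearZ/= /c (negbTE jk) -[_ *: _]/(_ * _) mulNr divfK// subrr.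
Qed.

End AlternatingAlgebra.

(** * Smooth functions and mixed derivatives *)

Section Derivatives.
Context {R : realType} {E : normedModType R}.
Implicit Types (f g : E -> R) (u v w x : E).

Lemma derive_comp_diff (F : normedModType R) (h : F -> E) f y (v : F) :
  differentiable h y -> differentiable f (h y) ->
  'D_v (fun z => f (h z)) y = 'D_('d h y v) f (h y).
Proof.
move=> dh df; rewrite !deriveE//; last exact: (differentiable_comp dh df).
by rewrite (diff_comp dh df).
Qed.

Lemma deriveDir f x (c : R) u w : differentiable f x ->
  'D_(c *: u + w) f x = c * 'D_u f x + 'D_w f x.
Proof. by move=> df; rewrite !deriveE// linearP. Qed.

Lemma derive_comb f g (c : R) x v : differentiable f x -> differentiable g x ->
  'D_v (fun y => c * f y + g y) x = c * 'D_v f x + 'D_v g x.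
Proof.
move=> /(@diff_derivable _ _ _ _ _ v) df /(@diff_derivable _ _ _ _ _ v) dg.
have dcf : derivable (c *: f) x v by exact: derivableZ.
by have := deriveD dcf dg; rewrite deriveZ.
Qed.

Lemma is_derive_line f x u (r : R) : differentiable f (x + r *: u) ->
  is_derive r 1 (fun s : R => f (x + s *: u)) ('D_u f (x + r *: u)).
Proof.
move=> df; have dl : is_diff r (fun s : R => x + s *: u) ( *:%R ^~ u).
  have := is_diffD (is_diff_cst x r) (is_diff_scalel r u).
  by rewrite add0r.
have dc : differentiable (fun s : R => f (x + s *: u)) r.
  by apply: (@differentiable_comp _ _ _ _ (fun s : R => x + s *: u) f).
apply: DeriveDef; first exact: diff_derivable.
rewrite (derive_comp_diff (h := fun s : R => x + s *: u))// diff_val.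
by rewrite  scale1r.
Qed.

End Derivatives.

Section SmoothFunctions.
Context {R : realType} {E : normedModType R}.
Implicit Types (f g : E -> R) (u v w x : E).

Lemma CkS k f : Ck k.+1 f -> Ck k f.
Proof.
elim: k f => [|k IH] f [df Df]; first by move=> x; exact: differentiable_continuous.
by split=> // v; apply: IH; apply: Df.
Qed.

Lemma smooth_differentiable f x : smooth f -> differentiable f x.
Proof. by move=> /(_ 1%N) []. Qed.

Lemma smooth_continuous f : smooth f -> continuous f.
Proof. by move=> /(_ 0%N). Qed.

Lemma smooth_derive f v : smooth f -> smooth (fun x => 'D_v f x).
Proof. by move=> sf k; have [_] := sf k.+1; apply. Qed.

Lemma Ck_cst k (c : R) : @Ck R E k (fun=> c).
Proof.
elim: k c => [|k IH] c /=; first exact: cst_continuous.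
split=> [x|v]; first exact: differentiable_cst.
by under eq_fun do rewrite derive_cst.
Qed.

Lemma CkD k f g : Ck k f -> Ck k g -> Ck k (fun x => f x + g x).
Proof.
elim: k f g => [|k IH] f g /=; first by move=> cf cg x; exact: (continuousD (cf x) (cg x)).
move=> [df Df] [dg Dg]; split=> [x|v]; first exact: (differentiableD (df x) (dg x)).
have -> : (fun x => 'D_v (fun x => f x + g x) x) = (fun x => 'D_v f x + 'D_v g x).
  by apply/funext => x; exact: (deriveD (diff_derivable (df x)) (diff_derivable (dg x))).
exact: IH.
Qed.

Lemma CkM k f g : Ck k f -> Ck k g -> Ck k (fun x => f x * g x).
Proof.
elim: k f g => [|k IH] f g; first by move=> cf cg x; exact: (continuousM (cf x) (cg x)).
move=> cf cg; have [[df Df] [dg Dg]] := (cf, cg).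
split=> [x|v]; first exact: (differentiableM (df x) (dg x)).
have -> : (fun x => 'D_v (fun x => f x * g x) x) =
    (fun x => f x * 'D_v g x + g x * 'D_v f x).
  by apply/funext => x; exact: (deriveM (diff_derivable (df x)) (diff_derivable (dg x))).
by apply: CkD; apply: IH; [exact: CkS|exact: Dg|exact: CkS|exact: Df].
Qed.

Lemma smooth_cst (c : R) : @smooth R E (fun=> c).
Proof. by move=> k; exact: Ck_cst. Qed.

Lemma smoothD f g : smooth f -> smooth g -> smooth (fun x => f x + g x).
Proof. by move=> sf sg k; exact: CkD. Qed.

Lemma smoothM f g : smooth f -> smooth g -> smooth (fun x => f x * g x).
Proof. by move=> sf sg k; exact: CkM. Qed.

Lemma smoothZ (c : R) f : smooth f -> smooth (fun x => c * f x).
Proof. by apply: smoothM; exact: smooth_cst. Qed.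

Lemma Ck_sum k n (F : 'I_n -> E -> R) :
  (forall i, Ck k (F i)) -> Ck k (fun x => \sum_i F i x).
Proof.
elim: n F => [|n IH] F sF.
  by under eq_fun do rewrite big_ord0; exact: Ck_cst.
by under eq_fun do rewrite big_ord_recl; apply: CkD => //; exact: IH.
Qed.

Lemma smooth_sum n (F : 'I_n -> E -> R) :
  (forall i, smooth (F i)) -> smooth (fun x => \sum_i F i x).
Proof. by move=> sF k; apply: Ck_sum => i; exact: sF. Qed.

Lemma derive_sumr n (F : 'I_n -> E -> R) x v :
  (forall i, differentiable (F i) x) ->
  'D_v (fun y => \sum_i F i y) x = \sum_i 'D_v (F i) x.
Proof.
move=> dF; rewrite -(@derive_sum _ _ _ _ F); last by move=> i; exact: diff_derivable.
by congr ('D_v _ x); apply/funext => y; rewrite fct_sumE.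
Qed.

(** The mean value theorem, applied once in each direction. *)
Lemma second_difference f x u v (h : R) : smooth f -> 0 < h ->
  exists r s, [/\ 0 < r < h, 0 < s < h &
  f (x + h *: u + h *: v) - f (x + h *: u) - (f (x + h *: v) - f x) =
  h ^+ 2 * 'D_v (fun y => 'D_u f y) (x + r *: u + s *: v)].
Proof.
move=> sf h0.
pose g (r : R) := f (x + h *: v + r *: u) - f (x + r *: u).
have dg (r : R) : is_derive r 1 g
    ('D_u f (x + h *: v + r *: u) - 'D_u f (x + r *: u)).
  by apply: (is_deriveB (is_derive_line _) (is_derive_line _));
    exact: smooth_differentiable.
have cont_of (l l' : R -> R) : (forall r : R, is_derive r 1 l (l' r)) ->
    {within `[0, h], continuous l}.
  move=> dl; apply: continuous_subspaceT => r.
  by apply: differentiable_continuous; apply/derivable1_diffP; have [] := dl r.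
have [r rh gr] := MVT h0 (fun r _ => dg r) (cont_of _ _ dg).
have dk (s : R) : is_derive s 1 (fun s : R => 'D_u f (x + r *: u + s *: v))
    ('D_v (fun y => 'D_u f y) (x + r *: u + s *: v)).
  by apply: is_derive_line; apply: smooth_differentiable; exact: smooth_derive.
have [s sh ks] := MVT h0 (fun s _ => dk s) (cont_of _ _ dk).
exists r, s; split; [by rewrite in_itv in rh|by rewrite in_itv in sh|].
move: gr ks; rewrite /g !subr0 !scale0r !addr0 => gr ks.
by rewrite [x + h *: u + h *: v]addrAC gr [x + h *: v + r *: u]addrAC ks; ring.
Qed.

(** Passage to the limit for two functions compared at different points, both
    tending to [x]. *)
Lemma eq_of_near_values (A B : E -> R) x u v :
  {for x, continuous A} -> {for x, continuous B} ->
  (forall h : R, 0 < h -> exists r s r' s' : R,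
    [/\ (0 < r < h) && (0 < s < h), (0 < r' < h) && (0 < s' < h)
      & A (x + r *: u + s *: v) = B (x + r' *: v + s' *: u)]) ->
  A x = B x.
Proof.
move=> cA cB AB; apply/eqP; rewrite -subr_eq0 -normr_le0; apply/ler_addgt0Pl => e e0.
rewrite addr0.
have near_of (C : E -> R) u' v' : {for x, continuous C} -> \forall z \near (0 : R * R),
   `|C x - C (x + z.1 *: u' + z.2 *: v')| < e / 2.
  move=> cC.
  have cg : (fun z : R * R => C (x + z.1 *: u' + z.2 *: v')) @ (0 : R * R) --> C x.
    have xE : x + (0 : R * R).1 *: u' + (0 : R * R).2 *: v' = x.
      by rewrite /= !scale0r !addr0.
    rewrite -{2}xE.
    apply: (@continuous_comp _ _ _ (fun z : R * R => x + z.1 *: u' + z.2 *: v') C);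
      last by rewrite xE.
    apply: continuousD; [apply: continuousD|]; first exact: cst_continuous.
    - by apply: continuousZr_tmp; exact: cvg_fst.
    - by apply: continuousZr_tmp; exact: cvg_snd.
  have /cvgrPdist_lt/(_ (e / 2)) := cg; rewrite divr_gt0// => /(_ isT).
  exact.
have /nbhs_ballP[d1 /= d10 H1] := near_of A u v cA.
have /nbhs_ballP[d2 /= d20 H2] := near_of B v u cB.
have h0 : 0 < Num.min d1 d2 by rewrite lt_min d10.
have in_ball d r s : 0 < r < d -> 0 < s < d -> ball (0 : R * R) d (r, s).
  move=> /andP[r0 rd] /andP[s0 sd].
  by split; rewrite /ball/= sub0r normrN gtr0_norm.
have [r [s [r' [s' []]]]] := AB _ h0.
rewrite !lt_min -!andbA => 
  /andP[r0 /andP[r1 /andP[_ /andP[s0 /andP[s1 _]]]]]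
  /andP[r'0 /andP[_ /andP[r'2 /andP[s'0 /andP[_ s'2]]]]] E1.
have {}H1 := H1 (r, s) (in_ball _ _ _ (introT andP (conj r0 r1)) (introT andP (conj s0 s1))).
have {}H2 := H2 (r', s') (in_ball _ _ _ (introT andP (conj r'0 r'2)) (introT andP (conj s'0 s'2))).
move: H1 H2; rewrite /= E1; set c := B (_ + _) => H1 H2.
rewrite [e]splitr; apply: (le_trans (ler_distD c _ _)).
by rewrite [`|c - _|]distrC; apply: lerD; exact: ltW.
Qed.

(** Both mixed derivatives are limits of the same second difference quotient. *)
Lemma derive_comm f x u v : smooth f ->
  'D_u (fun y => 'D_v f y) x = 'D_v (fun y => 'D_u f y) x.
Proof.
move=> sf; pose D u v y := 'D_u (fun y => 'D_v f y) y.
have cD u' v' : {for x, continuous (D u' v')}.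
  by apply: smooth_continuous; do 2! apply: smooth_derive.
apply: (eq_of_near_values (v := u) (u := v) (cD _ _) (cD _ _)) => h h0.
have [r [s [rh sh E1]]] := second_difference x v u sf h0.
have [r' [s' [r'h s'h E2]]] := second_difference x u v sf h0.
exists r, s, r', s'; split; [by rewrite rh|by rewrite r'h|].
apply: (@mulfI _ (h ^+ 2)); first by rewrite expf_neq0// gt_eqF.
rewrite -[LHS]E1 -[RHS]E2 [x + h *: v + h *: u]addrAC !opprD !opprK !addrA.
congr (_ + f x); exact: addrAC.
Qed.

End SmoothFunctions.

(** * The exterior derivative *)

Section ExteriorDerivative.
Context {R : realType} {E : normedModType R}.

Lemma dfwith_lift p (v : 'I_p.+1 -> E) k x i :
  (fun j => dfwith v k x (lift i j)) =
  if unlift i k is Some k' then dfwith (fun j => v (lift i j)) k' x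
  else (fun j => v (lift i j)).
Proof.
apply/funext => j; case: unliftP => [k' ->|->]; last by rewrite dfwithout// neq_lift.
have [->|jk'] := eqVneq j k'; first by rewrite !dfwithin.
by rewrite eq_sym in jk'; rewrite !dfwithout ?(inj_eq lift_inj).
Qed.

Section OneForm.
Context {p : nat} (w : dform E p).
Hypothesis fw : is_form w.

Lemma form_differentiable v x : differentiable (fun y => w y v) x.
Proof. by case: fw => _ _ sw; apply: smooth_differentiable. Qed.

Lemma exterior_d_multilinear x : multilinear (exterior_d w x).
Proof.
case: fw => mw _ _ v k c u h; rewrite /exterior_d mulr_sumr -big_split/=.
apply: eq_bigr => i _; rewrite !dfwith_lift mulrCA -mulrDr; congr (_ * _).
case: unliftP => [k' ->|<-].
  rewrite !dfwithout ?(eq_sym _ i) ?neq_lift//.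
  rewrite -derive_comb; [|exact: form_differentiable..].
  by congr ('D__ _ x); apply/funext => y; rewrite mw.
by rewrite !dfwithin deriveDir//; exact: form_differentiable.
Qed.

(** Omitting either one of two equal vectors leaves the same vectors up to a
    permutation, whose sign cancels the two terms. *)
Lemma exterior_d_alternating x : Defs.alternating (exterior_d w x).
Proof.
case: fw => mw aw _ v a b ab vab; rewrite /exterior_d.
rewrite (bigD1 a)//= (bigD1 b)/=; last by rewrite eq_sym.
rewrite [X in _ + (_ + X)]big1 ?addr0 => [|i /andP[ia ib]]; last first.
  have [a' aE|aE] := unliftP i a; last by rewrite aE eqxx in ia.
  have [b' bE|bE] := unliftP i b; last by rewrite bE eqxx in ib.
  rewrite (_ : (fun y => _) = cst 0) ?derive_cst ?mulr0//; apply/funext => y.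
  apply: (aw y _ a' b'); last by rewrite -aE -bE.
  by apply: contra ab => /eqP a'b'; rewrite aE bE a'b'.
have [t tE] := lift_perm_surj (tperm a b) b.
rewrite tpermR in tE.
have bE y : w y (fun j => v (lift b j)) = (-1) ^+ t * w y (fun j => v (lift a j)).
  rewrite -(alternating_perm (mw y) (aw y)); congr (w y); apply/funext => j.
  rewrite -(lift_perm_lift b) -tE.
  by case: tpermP => [->|->|].
have -> : (fun y => w y (fun j => v (lift b j))) =
   (fun y => (-1) ^+ t * w y (fun j => v (lift a j)) + cst 0 y).
  by apply/funext => y; rewrite addr0.
rewrite derive_comb; [|exact: form_differentiable|exact: differentiable_cst].
rewrite derive_cst addr0 -vab mulrA -mulrDl.
have := congr1 (@odd_perm _) tE; rewrite odd_tperm ab odd_lift_perm => oE.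
suff -> : (-1) ^+ a + (-1) ^+ b * (-1) ^+ t = 0 :> R by rewrite mul0r.
rewrite -signr_odd -[(-1) ^+ b]signr_odd -signr_addb.
move: oE; case: (odd a) (odd b) (odd_perm t) => [] [] []//= _;
  by rewrite ?expr0 ?expr1 ?subrr ?addNr.
Qed.

Lemma exterior_d_form : is_form (exterior_d w).
Proof.
split; [exact: exterior_d_multilinear|exact: exterior_d_alternating|].
move=> v; apply: smooth_sum => i; apply: smoothZ; apply: smooth_derive.
by case: fw.
Qed.

End OneForm.

(** The differential of an affine map is constant, so that no second derivative
    enters. *)
Lemma exterior_d_pullback_affine p (w : dform E p) (f L : E -> E) :
  is_form w -> (forall x, is_diff x f L) ->
  pullback f (exterior_d w) = exterior_d (pullback f w).
Proof.
move=> fw df; apply/funext => x; apply/funext => v.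
rewrite /pullback /exterior_d; apply: eq_bigr => i _; congr (_ * _).
have dfE y : 'd f y = L :> (E -> E) by apply: diff_val.
under [in RHS]eq_fun do under eq_fun do rewrite dfE.
under eq_fun do under eq_fun do rewrite dfE.
have dx : differentiable f x by [].
have dw : differentiable (fun y => w y (fun j => L (v (lift i j)))) (f x).
  exact: form_differentiable.
exact/esym/(derive_comp_diff (v i) dx dw).
Qed.

Lemma exterior_d_comb p (w h : dform E p) (c : R) : is_form w -> is_form h ->
  exterior_d (c *: w + h) = c *: exterior_d w + exterior_d h.
Proof.
move=> fw fh; apply/funext => x; apply/funext => v.
rewrite /exterior_d !fctE/= /exterior_d scaler_sumr -big_split/=.
apply: eq_bigr => i _; rewrite -[_ *: _]/(_ * _) mulrCA -mulrDr; congr (_ * _).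
by rewrite -derive_comb//; exact: form_differentiable.
Qed.

Lemma exterior_dZ p (w : dform E p) (c : R) : is_form w ->
  exterior_d (c *: w) = c *: exterior_d w.
Proof.
by move=> fw; have := exterior_d_comb (c - 1) fw fw; rewrite !scalerBl !scale1r !subrK.
Qed.

Lemma is_form_comb p (w h : dform E p) (c : R) : is_form w -> is_form h ->
  is_form (c *: w + h).
Proof.
move=> [mw aw sw] [mh ah sh]; split=> [x v i k u z|x v i j ij vij|v].
- have ZE (a b : R) : a *: b = a * b by [].
  by rewrite !fctE/= !ZE mw mh; ring.
- by rewrite !fctE/= (aw _ _ _ _ ij vij) (ah _ _ _ _ ij vij) scaler0 addr0.
- by apply: smoothD; [apply: smoothZ; exact: sw|exact: sh].
Qed.

End ExteriorDerivative.

(** * Pullback of forms by a shearing flow *)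

Section Pullback.
Context {R : realType} {E F : normedModType R}.
Implicit Types (f : E -> F).

Lemma pullback_multilinear p (w : dform F p) f : (forall x, multilinear (w x)) ->
  forall x, multilinear (pullback f w x).
Proof.
move=> mw x v i c u h.
have dE z : (fun j => 'd f x (dfwith v i z j)) = dfwith (fun j => 'd f x (v j)) i ('d f x z).
  apply/funext => j; have [->|ji] := eqVneq j i; first by rewrite !dfwithin.
  by rewrite eq_sym in ji; rewrite !dfwithout.
by rewrite /pullback !dE linearP mw.
Qed.

Lemma pullback_alternating p (w : dform F p) f :
  (forall x, Defs.alternating (w x)) ->
  forall x, Defs.alternating (pullback f w x).
Proof. by move=> aw x v i j ij vij; apply: (aw _ _ i j) => //; rewrite vij. Qed.

Lemma pullback_comp (G : normedModType R) p (w : dform G p) f (g : F -> G) :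
  (forall x, differentiable f x) -> (forall x, differentiable g x) ->
  pullback f (pullback g w) = pullback (g \o f) w.
Proof.
move=> df dg; apply/funext => x; apply/funext => v.
rewrite /pullback; congr (w _); apply/funext => i.
exact: (esym (congr1 (fun h => h (v i)) (diff_comp (df x) (dg (f x))))).
Qed.

End Pullback.

(** A flow [x |-> x + s exp (c tau x) e] along the level sets of a linear form
    [tau]: of this kind is the flow of the left invariant field of the torus,
    with [tau] the last coordinate. *)
Section Shear.
Context {R : realType} {E : normedModType R} (tau : {linear E -> R}).
Hypothesis tau_cont : continuous tau.
Context (e : E) (c : R).
Hypothesis tau_e : tau e = 0.
Implicit Types (f : E -> R) (x : E) (s r : R).

Definition shear_speed x : R := expR (c * tau x).

Definition shear s x : E := x + (s * shear_speed x) *: e.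

Local Notation kap := shear_speed.

Lemma shear_speed_shift x r : kap (x + r *: e) = kap x.
Proof. by rewrite /shear_speed linearD linearZ/= tau_e -[_ *: _]/(_ * _) mulr0 addr0. Qed.

Lemma shear0 : shear 0 = id.
Proof. by apply/funext => x; rewrite /shear mul0r scale0r addr0. Qed.

Lemma shear_comp s r : shear s \o shear r = shear (r + s).
Proof.
apply/funext => x; rewrite /shear /= shear_speed_shift -addrA -scalerDl.
by rewrite -mulrDl.
Qed.

Lemma is_diff_tau x : is_diff x tau tau.
Proof. by apply: DiffDef; [exact: linear_differentiable|exact: diff_lin]. Qed.

Lemma is_diff_shear_speed x : is_diff x kap (fun v => c * tau v * kap x).
Proof.
have dexp : is_diff (c * tau x) expR ( *:%R ^~ (expR (c * tau x))).
  have d1 := is_derive_expR (c * tau x).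
  apply: DiffDef; first by apply/derivable1_diffP; case: d1.
  by rewrite deriv1E ?derive1E ?derive_val//; case: d1.
have dct : is_diff x (c *: (tau : E -> R)) (c *: (tau : E -> R)).
  exact: (is_diffZ c (is_diff_tau x)).
exact: (is_diff_comp dct dexp).
Qed.

Lemma is_diff_shear s x :
  is_diff x (shear s) (fun v => v + (s * (c * tau v * kap x)) *: e).
Proof.
have := is_diffD (is_diff_id x) (is_diff_comp
  (is_diffZ s (is_diff_shear_speed x)) (is_diff_scalel (s * kap x) e)).
exact.
Qed.

Lemma differentiable_shear s x : differentiable (shear s) x.
Proof. by case: (is_diff_shear s x). Qed.

Lemma diff_shear s x v : 'd (shear s) x v = v + (s * (c * tau v * kap x)) *: e.
Proof.
by have := @diff_val _ _ _ _ _ _ _ (is_diff_shear s x) => /(congr1 (fun h => h v)).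
Qed.

Lemma derive_shear_speed x v : 'D_v kap x = c * tau v * kap x.
Proof.
rewrite deriveE; last by case: (is_diff_shear_speed x).
by rewrite (@diff_val _ _ _ _ _ _ _ (is_diff_shear_speed x)).
Qed.

Lemma smooth_shear_speed : smooth kap.
Proof.
elim=> [|k IH].
  by move=> x; apply: differentiable_continuous; case: (is_diff_shear_speed x).
split=> [x|v]; first by case: (is_diff_shear_speed x).
have -> : (fun x => 'D_v kap x) = (fun x => c * tau v * kap x).
  by apply/funext => x; exact: derive_shear_speed.
by apply: CkM => //; exact: Ck_cst.
Qed.

Lemma derive_shear s f x v : differentiable f (shear s x) ->
  'D_v (fun y => f (shear s y)) x =
  'D_v f (shear s x) + s * (c * tau v * kap x) * 'D_e f (shear s x).
Proof.
move=> df; rewrite (derive_comp_diff v (differentiable_shear s x))//.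
by rewrite diff_shear addrC deriveDir// addrC.
Qed.

(** By [derive_shear] the derivatives of [f] along the flow are combinations, with
    smooth coefficients, of functions of the same shape; hence the induction on
    the class, for all [f] at once. *)
Lemma smooth_shear s f : smooth f -> smooth (fun x => f (shear s x)).
Proof.
move=> sf k; elim: k f sf => [|k IH] f sf.
  move=> x; apply: continuous_comp.
    exact: differentiable_continuous (differentiable_shear s x).
  exact: smooth_continuous.
split=> [x|v].
  apply: (@differentiable_comp _ _ _ _ (shear s) f); first exact: differentiable_shear.
  exact: smooth_differentiable.
have -> : (fun x => 'D_v (fun y => f (shear s y)) x) =
    (fun x => 'D_v f (shear s x) + s * (c * tau v) * kap x * 'D_e f (shear s x)).
  apply/funext => x; rewrite derive_shear; last exact: smooth_differentiable.
  by rewrite !mulrA.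
apply: CkD; first by apply: (IH (fun x => 'D_v f x)); exact: smooth_derive.
apply: CkM; last by apply: (IH (fun x => 'D_e f x)); exact: smooth_derive.
by apply: CkM; [exact: Ck_cst|exact: smooth_shear_speed].
Qed.

Section PullbackShear.
Context {p : nat}.
Implicit Types (w : dform E p).

(** The differential of the flow adds to each argument a multiple of [e]
    proportional to its [tau]-coordinate. *)
Lemma pullback_shearE s w x v : is_form w ->
  pullback (shear s) w x v = w (shear s x) v +
    \sum_j s * (c * tau (v j) * kap x) * w (shear s x) (dfwith v j e).
Proof.
move=> [mw aw _]; rewrite /pullback; under eq_fun do rewrite diff_shear.
exact: alternating_shear.
Qed.

Lemma pullback_shear_form s w : is_form w -> is_form (pullback (shear s) w).
Proof.
move=> fw; have [mw aw sw] := fw; split.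
- by apply: pullback_multilinear.
- by apply: pullback_alternating.
- move=> v; under eq_fun do rewrite pullback_shearE//.
  apply: smoothD; first exact: (smooth_shear s (sw v)).
  apply: smooth_sum => j; apply: smoothM; last exact: (smooth_shear s (sw _)).
  by apply: smoothZ; apply: smoothZ; exact: smooth_shear_speed.
Qed.

Lemma pullback_shear_comp s r w :
  pullback (shear s) (pullback (shear r) w) = pullback (shear (s + r)) w.
Proof.
rewrite pullback_comp ?shear_comp//; exact: differentiable_shear.
Qed.

Lemma pullback_shear0 w : pullback (shear 0) w = w.
Proof.
apply/funext => x; apply/funext => v; rewrite /pullback shear0; congr (w x).
by apply/funext => j; rewrite -shear0 diff_shear mul0r scale0r addr0.
Qed.

End PullbackShear.

(** Both sides being alternating, it suffices to compare them on vectors all but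
    one of which are in the kernel of [tau]; then the second derivatives of the
    flow, proportional to a product of two values of [tau], do not contribute. *)
Lemma exterior_d_pullback_shear p (w : dform E p) s : is_form w ->
  exterior_d (pullback (shear s) w) = pullback (shear s) (exterior_d w).
Proof.
move=> fw; have [mw aw sw] := fw.
have [mdw adw _] := exterior_d_form fw.
have [mdl adl _] := exterior_d_form (pullback_shear_form s fw).
apply/funext => x; apply: (eq_alternating_pivot (tau := tau) (mdl x) (adl x)).
- by apply: pullback_multilinear.
- by apply: pullback_alternating.
move=> v k tv; rewrite pullback_shearE; last exact: exterior_d_form.
rewrite (bigD1 k)//= [X in _ + (_ + X)]big1 ?addr0; last first.
  by move=> j jk; rewrite tv// mulr0 mul0r mulr0 mul0r.
rewrite /exterior_d mulr_sumr -big_split/=; apply: eq_bigr => i _.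
rewrite mulrCA -mulrDr; congr (_ * _).
have dws u y : differentiable (fun y => w (shear s y) u) y.
  by apply: smooth_differentiable; apply: (@smooth_shear s (fun y => w y u)).
pose v' j := v (lift i j).
(* Either the vector outside the kernel of [tau] is the direction of
   differentiation, or it is the argument of index [k'] of the form. *)
have [k' kE|ki] := unliftP i k; last first.
  have -> : (fun y => pullback (shear s) w y v') = (fun y => w (shear s y) v').
    apply/funext => y; rewrite pullback_shearE// big1 ?addr0// => j _.
    by rewrite tv ?mulr0 ?mul0r ?mulr0 ?mul0r// ki eq_sym neq_lift.
  rewrite (derive_shear (f := fun y => w y v')); last exact: form_differentiable.
  by rewrite dfwith_lift ki unlift_none dfwithin.
have ti : tau (v i) = 0 by rewrite tv// kE neq_lift.
have -> : (fun y => pullback (shear s) w y v') = (fun y => w (shear s y) v' +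
    s * (c * tau (v k) * kap y) * w (shear s y) (dfwith v' k' e)).
  apply/funext => y; rewrite pullback_shearE// (bigD1 k')//= big1 ?addr0.
    by rewrite /v' -kE.
  move=> j jk'; rewrite tv ?mulr0 ?mul0r ?mulr0 ?mul0r//.
  by rewrite kE (inj_eq lift_inj).
have dK y : differentiable (fun y => s * (c * tau (v k) * kap y)) y.
  by apply: smooth_differentiable; do 2! apply: smoothZ; exact: smooth_shear_speed.
rewrite [LHS](deriveD (diff_derivable (dws _ _))
  (diff_derivable (differentiableM (dK x) (dws _ _)))).
rewrite (deriveM (diff_derivable (dK x)) (diff_derivable (dws _ _))).
rewrite !(derive_shear (f := fun y => w y _)) ?ti; [|exact: form_differentiable..].
have -> : 'D_(v i) (fun y => s * (c * tau (v k) * kap y)) x = 0.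
  rewrite (_ : (fun y => _) = (fun y => s * (c * tau (v k)) * kap y + cst 0 y)); last first.
    by apply/funext => y; rewrite addr0 mulrA.
  have dkap : differentiable kap x by case: (is_diff_shear_speed x).
  by rewrite derive_comb// derive_cst addr0 derive_shear_speed ti mulr0 mul0r mulr0.
rewrite scaler0 addr0 !(mulr0, mul0r) !addr0; congr (_ + _).
by rewrite dfwith_lift kE liftK dfwithout// eq_sym neq_lift.
Qed.

End Shear.

(** * The Lie derivative along a shearing flow *)

Section LieDerivativeShear.
Context {R : realType} {E : normedModType R} (tau : {linear E -> R}).
Hypothesis tau_cont : continuous tau.
Context (e : E) (c : R).
Hypothesis tau_e : tau e = 0.
Implicit Types (f : E -> R) (x : E) (s r : R).

Local Notation kap := (shear_speed tau c).
Local Notation shear := (shear tau e c).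

Lemma is_derive_shear_time f x s : differentiable f (shear s x) ->
  is_derive s 1 (fun r => f (shear r x)) (kap x * 'D_e f (shear s x)).
Proof.
move=> df.
have E1 r : shear r x = x + r *: (kap x *: e) by rewrite scalerA.
have -> : (fun r => f (shear r x)) = (fun r => f (x + r *: (kap x *: e))).
  by apply/funext => r; rewrite E1.
rewrite E1 in df *.
have -> : kap x * 'D_e f (x + s *: (kap x *: e)) =
          'D_(kap x *: e) f (x + s *: (kap x *: e)).
  by have := deriveDir (kap x) e 0 df; rewrite addr0 derive0 addr0 => ->.
exact: is_derive_line.
Qed.

Lemma is_derive_sumr n (F : 'I_n -> R -> R) (dF : 'I_n -> R) s :
  (forall i, is_derive s 1 (F i) (dF i)) ->
  is_derive s 1 (fun r => \sum_i F i r) (\sum_i dF i).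
Proof.
move=> H; have -> : (fun r => \sum_i F i r) = \sum_i F i.
  by apply/funext => r; rewrite fct_sumE.
exact: is_derive_sum.
Qed.

(** The derivative in [s] of the expansion [pullback_shearE]; at [s = 0] it is the
    Lie derivative of [w]. *)
Definition pullback_shear_dot p (w : dform E p) s x v : R :=
  kap x * 'D_e (fun y => w y v) (shear s x) +
  \sum_j c * tau (v j) * kap x * (w (shear s x) (dfwith v j e) +
    s * (kap x * 'D_e (fun y => w y (dfwith v j e)) (shear s x))).

Lemma is_derive_pullback_shear p (w : dform E p) s x v : is_form w ->
  is_derive s 1 (fun r => pullback (shear r) w x v) (pullback_shear_dot w s x v).
Proof.
move=> fw; have [_ _ sw] := fw.
have -> : (fun r => pullback (shear r) w x v) = (fun r => w (shear r x) v +
    \sum_j c * tau (v j) * kap x * (r * w (shear r x) (dfwith v j e))).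
  apply/funext => r; rewrite pullback_shearE//; congr (_ + _).
  by apply: eq_bigr => j _; rewrite [in RHS]mulrCA -mulrA.
apply: is_deriveD.
  by apply: (@is_derive_shear_time (fun y => w y v)); exact: form_differentiable.
apply: is_derive_sumr => j.
have dj : is_derive s 1 (fun r => w (shear r x) (dfwith v j e))
    (kap x * 'D_e (fun y => w y (dfwith v j e)) (shear s x)).
  by apply: (@is_derive_shear_time (fun y => w y _)); exact: form_differentiable.
have H := is_deriveZ (c * tau (v j) * kap x) (is_deriveM (is_derive_id s 1) dj).
apply: (is_derive_eq H).
by rewrite -![_ *: _]/(_ * _) mulr1 [s * _ + _]addrC.
Qed.

Lemma continuous_pullback_shear_dot p (w : dform E p) x v : is_form w ->
  continuous (fun s => pullback_shear_dot w s x v).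
Proof.
move=> [_ _ sw].
have cf f : smooth f -> @Ck R R 0 (fun s => f (shear s x)).
  move=> sf s; apply: differentiable_continuous; apply/derivable1_diffP.
  by have [] := @is_derive_shear_time f x s (smooth_differentiable _ sf).
have sDw u : smooth (fun y => 'D_e (fun y => w y u) y) by exact: smooth_derive.
suff : @Ck R R 0 (fun s => pullback_shear_dot w s x v) by [].
apply: CkD; first by apply: CkM; [exact: Ck_cst|exact: cf (sDw v)].
apply: Ck_sum => j; apply: CkM; first exact: Ck_cst.
apply: CkD; first exact: cf (sw _).
apply: CkM; first by move=> s; exact: cvg_id.
by apply: CkM; [exact: Ck_cst|exact: cf (sDw _)].
Qed.

Lemma lie_derivative_shearE p (w : dform E p) x v : is_form w ->
  lie_derivative shear w x v = pullback_shear_dot w 0 x v.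
Proof.
move=> fw; rewrite /lie_derivative derive1E.
exact: (@derive_val _ _ _ _ _ _ _ (is_derive_pullback_shear 0 x v fw)).
Qed.

(** By the group law, the derivative of the pullback at time [s] is the pullback
    at time [s] of its derivative at time [0]. *)
Lemma pullback_lie_derivative_shear p (w : dform E p) s x v : is_form w ->
  pullback (shear s) (lie_derivative shear w) x v = pullback_shear_dot w s x v.
Proof.
move=> fw; pose F r := pullback (shear r) w x v.
have dF : is_derive s 1 F (pullback_shear_dot w s x v) by exact: is_derive_pullback_shear.
rewrite /pullback /lie_derivative.
have -> : (fun r => pullback (shear r) w (shear s x) (fun i => 'd (shear s) x (v i)))
   = (fun r => F (s + r *: 1)).
  apply/funext => r; rewrite -[r *: 1]/(r * 1) mulr1.
  by rewrite /F -pullback_shear_comp.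
rewrite derive1E.
have dFs : differentiable F (s + (0 : R) *: 1).
  by rewrite scale0r addr0; apply/derivable1_diffP; case: dF.
rewrite (@derive_val _ _ _ _ _ _ _ (is_derive_line dFs)) scale0r addr0.
by rewrite derive_val.
Qed.

Lemma derive_mul f g x u : differentiable f x -> differentiable g x ->
  'D_u (fun y => f y * g y) x = f x * 'D_u g x + g x * 'D_u f x.
Proof. by move=> df dg; exact: (deriveM (diff_derivable df) (diff_derivable dg)). Qed.

Lemma is_derive_mulid (G : R -> R) dG : is_derive (0 : R) 1 G dG ->
  is_derive (0 : R) 1 (fun s => s * G s) (G 0).
Proof.
move=> HG; have H := is_deriveM (is_derive_id (0 : R) 1) HG.
by apply: (is_derive_eq H); rewrite scale0r add0r -[_ *: _]/(_ * _) mulr1.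
Qed.

(** The derivatives in time and in space are exchanged by the symmetry of the
    mixed derivatives along [e] and [u]; the term coming from the differential of
    the flow is the one coming from the derivative of its speed. *)
Lemma is_derive_time_derive_shear f x u : smooth f ->
  is_derive (0 : R) 1 (fun s => 'D_u (fun y => f (shear s y)) x)
    ('D_u (fun y => kap y * 'D_e f y) x).
Proof.
move=> sf.
have sDe := smooth_derive e sf; have sDu := smooth_derive u sf.
have -> : (fun s => 'D_u (fun y => f (shear s y)) x) =
    (fun s => 'D_u f (shear s x) + c * tau u * kap x * (s * 'D_e f (shear s x))).
  apply/funext => s; rewrite derive_shear//; last exact: smooth_differentiable.
  by congr (_ + _); rewrite [in RHS]mulrCA -mulrA.
have d1 := is_derive_shear_time (smooth_differentiable (shear 0 x) sDu).
have d2 := is_derive_mulid (is_derive_shear_time (smooth_differentiable (shear 0 x) sDe)).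
have H := is_deriveD d1 (is_deriveZ (c * tau u * kap x) d2).
apply: (is_derive_eq H); rewrite shear0 /= derive_mul; last 2 first.
- by case: (is_diff_shear_speed tau_cont c x).
- exact: smooth_differentiable.
rewrite -[_ *: _]/(_ * _) (derive_comm _ e u)//; congr (_ + _).
by rewrite derive_shear_speed// mulrC.
Qed.

Lemma is_derive_time_derive_mulshear (a f : E -> R) x u : smooth a -> smooth f ->
  is_derive (0 : R) 1 (fun s => 'D_u (fun y => s * (a y * f (shear s y))) x)
    ('D_u (fun y => a y * f y) x).
Proof.
move=> sa sf.
have dfs s : differentiable (fun y => f (shear s y)) x.
  by apply: smooth_differentiable; exact: smooth_shear.
have da : differentiable a x by exact: smooth_differentiable.
have -> : (fun s => 'D_u (fun y => s * (a y * f (shear s y))) x) =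
  (fun s => s * 'D_u (fun y => a y * f (shear s y)) x).
  apply/funext => s.
  have -> : (fun y => s * (a y * f (shear s y))) =
     (fun y => s * (a y * f (shear s y)) + cst 0 y) by apply/funext => y; rewrite addr0.
  rewrite derive_comb; [|exact: differentiableM|exact: differentiable_cst].
  by rewrite derive_cst addr0.
have [dG HG] : exists dG, is_derive (0 : R) 1
    (fun s => 'D_u (fun y => a y * f (shear s y)) x) dG.
  have d1 := is_derive_time_derive_shear x u sf.
  have d2 := is_derive_shear_time (smooth_differentiable (shear 0 x) sf).
  eexists; have := is_deriveD (is_deriveZ (a x) d1) (is_deriveZ ('D_u a x) d2).
  congr (is_derive _ _ _ _); apply/funext => s.
  by rewrite derive_mul// [X in _ = _ + X]mulrC.
by have := is_derive_mulid HG; rewrite shear0.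
Qed.

(** The time derivative at [0] of the naturality [exterior_d_pullback_shear]. *)
Lemma exterior_d_lie_derivative_shear p (w : dform E p) : is_form w ->
  exterior_d (lie_derivative shear w) = lie_derivative shear (exterior_d w).
Proof.
move=> fw; have [_ _ sw] := fw.
apply/funext => x; apply/funext => v; rewrite /lie_derivative derive1E.
have -> : (fun s => pullback (shear s) (exterior_d w) x v) =
  (fun s => \sum_(i < p.+1) (-1) ^+ i *
     'D_(v i) (fun y => pullback (shear s) w y (fun j => v (lift i j))) x).
  by apply/funext => s; rewrite -exterior_d_pullback_shear.
have {}main u h : is_derive (0 : R) 1
    (fun s => 'D_u (fun y => pullback (shear s) w y h) x)
    ('D_u (fun y => lie_derivative shear w y h) x).
  have sa j : smooth (fun y => c * tau (h j) * kap y).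
    by apply: smoothZ; exact: smooth_shear_speed.
  have sb j : smooth (fun y => c * tau (h j) * kap y * w y (dfwith h j e)).
    exact: smoothM.
  have -> : (fun s => 'D_u (fun y => pullback (shear s) w y h) x) =
    (fun s => 'D_u (fun y => w (shear s y) h) x +
       \sum_j 'D_u (fun y => s * (c * tau (h j) * kap y * w (shear s y) (dfwith h j e))) x).
    apply/funext => s.
    have st j : smooth (fun y => s * (c * tau (h j) * kap y * w (shear s y) (dfwith h j e))).
      by apply: smoothZ; apply: smoothM => //; exact: (smooth_shear tau_cont e c s (sw _)).
    have -> : (fun y => pullback (shear s) w y h) = (fun y => w (shear s y) h +
       \sum_j s * (c * tau (h j) * kap y * w (shear s y) (dfwith h j e))).
      apply/funext => y; rewrite pullback_shearE//; congr (_ + _).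
      by apply: eq_bigr => j _; rewrite !mulrA.
    rewrite -derive_sumr; last by move=> j; exact: smooth_differentiable.
    apply: deriveD; apply: diff_derivable; apply: smooth_differentiable.
      exact: (smooth_shear tau_cont e c s (sw _)).
    exact: smooth_sum.
  have -> : 'D_u (fun y => lie_derivative shear w y h) x =
    'D_u (fun y => kap y * 'D_e (fun y => w y h) y) x +
    \sum_j 'D_u (fun y => c * tau (h j) * kap y * w y (dfwith h j e)) x.
    rewrite -derive_sumr; last by move=> j; exact: smooth_differentiable.
    have -> : (fun y => lie_derivative shear w y h) =
      (fun y => kap y * 'D_e (fun y => w y h) y +
        \sum_j c * tau (h j) * kap y * w y (dfwith h j e)).
      apply/funext => y; rewrite lie_derivative_shearE// /pullback_shear_dot shear0.
      by congr (_ + _); apply: eq_bigr => j _; rewrite mul0r addr0.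
    apply: deriveD; apply: diff_derivable; apply: smooth_differentiable.
      by apply: smoothM; [exact: smooth_shear_speed|exact: smooth_derive].
    exact: smooth_sum.
  apply: is_deriveD; first exact: (is_derive_time_derive_shear x u (sw h)).
  apply: is_derive_sumr => j.
  exact: (is_derive_time_derive_mulshear x u (sa j) (sw _)).
apply/esym; apply: (@derive_val _ _ _ _ _ _ _ _).
by apply: is_derive_sumr => i; exact: is_deriveZ.
Qed.

End LieDerivativeShear.

(** * Fibre integration along a flow *)

Section FibreIntegral.
Context {R : realType} {E : normedModType R}.

Lemma lift_perm_inj n (i j : 'I_n.+1) : injective (@lift_perm n i j).
Proof.
move=> s t st; apply/permP => k; apply: (@lift_inj _ j).
by rewrite -!(lift_perm_lift i) st.
Qed.

(** The sum defining the wedge of [f] with a form of degree one that only sees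
    the first of the vectors [V]: the surviving permutations are the
    [lift_perm ord_max ord0 t], and by alternation each contributes the same
    term. The index type is a variable [n] because the degree of a wedge is
    [p + 1], which is [p.+1] only up to a proof. *)
Lemma sum_perm_last (F : normedModType R) p n (en : n = p.+1) (l : 'I_p -> 'I_n) (r : 'I_n)
    (f : ('I_p -> F) -> R) (V : 'I_p.+1 -> F) (b : 'I_p.+1 -> R) :
  (forall i, l i = i :> nat) -> r = p :> nat ->
  multilinear f -> Defs.alternating f ->
  b ord0 = 1 -> (forall i, b (lift ord0 i) = 0) ->
  \sum_(s : 'S_n) (-1) ^+ s *
     (f (fun i => V (cast_ord en (s (l i)))) * b (cast_ord en (s r))) =
  p`!%:R * ((-1) ^+ p * f (fun i => V (lift ord0 i))).
Proof.
subst n => lE rE mf af b0 b1.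
have {lE}lE i : l i = lift ord_max i by apply/val_inj; rewrite /= lE /bump leqNgt ltn_ord.
have {rE}-> : r = ord_max by apply/val_inj.
transitivity (\sum_(s : 'S_p.+1 | s ord_max == ord0) (-1) ^+ p * f (fun i => V (lift ord0 i)));
    last first.
  rewrite sumr_const mulr_natl; congr (_ *+ _).
  have <- : #|[set lift_perm (@ord_max p) ord0 t | t in [set: 'S_p]]%SET| = p`!.
    by rewrite (card_imset _ (@lift_perm_inj _ _ _)) cardsT card_Sn.
  apply: eq_card => s; apply/idP/imsetP => [/eqP s0|[t _ ->]].
    2: by rewrite -topredE /= lift_perm_id.
  have {}s0 : s ord_max = ord0 by exact: val_inj.
  by have [t tE] := lift_perm_surj s ord_max; exists t; rewrite ?inE// {1}tE s0.
rewrite [RHS]big_mkcond/=; apply: eq_bigr => s _; rewrite cast_ord_id.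
under eq_fun do rewrite cast_ord_id lE.
have [s0|s0] := eqVneq; last first.
  case: (unliftP ord0 (s ord_max)) s0 => [k ->|->]; last by rewrite eqxx.
  by rewrite b1 !mulr0.
have [t tE] := lift_perm_surj s ord_max; rewrite s0 in tE.
rewrite s0 b0 mulr1 tE.
under eq_fun do rewrite lift_perm_lift.
rewrite (alternating_perm mf af t (fun i => V (lift ord0 i))).
by rewrite odd_lift_perm /= addbF signr_addb signr_odd -mulrA signrMK.
Qed.

(** At [(x, s)] the contracted vector is the only one on which [ds] does not
    vanish; the sign is that of the cycle which moves it behind the [p] others. *)
Lemma flow_integralE p (phi : R -> E -> E) (eta : dform E p) x v :
  (forall y, multilinear (eta y)) -> (forall y, Defs.alternating (eta y)) ->
  (forall z, differentiable (fun z : E * R => phi z.2 z.1) z) ->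
  flow_integral phi eta x v =
  \int[@lebesgue_measure R]_(s in `[0, 1]) ((-1) ^+ p * pullback (phi s) eta x v).
Proof.
move=> meta aeta dphi; rewrite /flow_integral /fiber_integral; congr Rintegral.
apply/funext => s; rewrite {1}/pullback /Defs.contraction.
have dins y : is_diff y (fun m : E => (m, s : R) : E * R) (fun u => (u, 0)).
  exact: (is_diff_pair (is_diff_id y) (is_diff_cst s y)).
have dsnd (z : E * R) : is_diff z (fun z : E * R => z.2) (fun z => z.2).
  have c2 : continuous (snd : E * R -> R) by move=> ?; exact: cvg_snd.
  by apply: DiffDef; [exact: linear_differentiable|exact: diff_lin].
pose V (i : 'I_p.+1) : E * R := oapp (fun j => (v j, 0)) (0, 1) (unlift ord0 i).
rewrite [X in form_cast _ _ _ X](_ : _ = V); last first.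
  apply/funext => i; rewrite /V; case: unlift => //= j.
  by rewrite (@diff_val _ _ _ _ _ _ _ (dins x)).
have Vlift j : V (lift ord0 j) = (v j, 0) by rewrite /V liftK.
have V0 : V ord0 = (0, 1) by rewrite /V unlift_none.
rewrite /form_cast /wedge_form /=.
set f := pullback (fun z : E * R => phi z.2 z.1) eta (x, s).
pose b (i : 'I_p.+1) := (V i).2.
have hE (t : 'S_(p + 1)) : pullback (fun z : E * R => z.2) (@volume_form R) (x, s)
    (fun j => V (cast_ord (addn1 p) (t (rshift p j)))) =
    b (cast_ord (addn1 p) (t (rshift p ord0))).
  by rewrite /pullback /volume_form (@diff_val _ _ _ _ _ _ _ (dsnd (x, s))).
under eq_bigr do rewrite hE.
have mf : multilinear f.
  by apply: pullback_multilinear => z; exact: meta.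
have af : Defs.alternating f.
  by apply: pullback_alternating => z; exact: aeta.
rewrite (@sum_perm_last _ p _ (addn1 p) (lshift 1) (rshift p ord0) f V b)//; last 3 first.
- by rewrite /= addn0.
- by rewrite /b V0.
- by move=> i; rewrite /b Vlift.
rewrite muln1 mulKf ?pnatr_eq0 -?lt0n ?fact_gt0//; congr (_ * _).
have -> : (fun i => V (lift ord0 i)) = (fun i => (v i, 0)).
  by apply/funext => i; rewrite Vlift.
rewrite /f /pullback /=; congr (eta _); apply/funext => i.
have -> : phi s = (fun z : E * R => phi z.2 z.1) \o (fun m : E => (m, s : R) : E * R) by [].
have := congr1 (fun h => h (v i)) (diff_comp (@ex_diff _ _ _ _ _ _ _ (dins x)) (dphi (x, s))).
move=> ->; rewrite /=.
by rewrite (@diff_val _ _ _ _ _ _ _ (dins x)).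
Qed.

End FibreIntegral.

Section FlowIntegralShear.
Context {R : realType} {E : normedModType R} (tau : {linear E -> R}).
Hypothesis tau_cont : continuous tau.
Context (e : E) (c : R).
Hypothesis tau_e : tau e = 0.

Local Notation shear := (shear tau e c).

Lemma differentiable_shear_joint (z : E * R) :
  differentiable (fun z : E * R => shear z.2 z.1) z.
Proof.
have d1 : differentiable (fun z : E * R => z.1) z.
  by apply: (@linear_differentiable _ _ _ fst) => ?; exact: cvg_fst.
have d2 : differentiable (fun z : E * R => z.2) z.
  by apply: (@linear_differentiable _ _ _ snd) => ?; exact: cvg_snd.
have dk : differentiable (fun z : E * R => shear_speed tau c z.1) z.
  apply: (@differentiable_comp _ _ _ _ (fun z : E * R => z.1) (shear_speed tau c)) => //.
  by case: (is_diff_shear_speed tau_cont c z.1).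
apply: (differentiableD d1).
apply: (@differentiable_comp _ _ _ _ (fun z : E * R => z.2 * shear_speed tau c z.1) ( *:%R ^~ e)).
  exact: differentiableM.
by case: (is_diff_scalel (z.2 * shear_speed tau c z.1) e).
Qed.

Lemma lie_derivative_shear_multilinear p (w : dform E p) x : is_form w ->
  multilinear (lie_derivative shear w x).
Proof.
move=> fw; have [mw _ _] := fw; move=> v i k u h; rewrite /lie_derivative !derive1E.
pose F z s := pullback (shear s) w x (dfwith v i z).
have dF z : is_derive (0 : R) 1 (F z) (pullback_shear_dot tau e c w 0 x (dfwith v i z)).
  exact: is_derive_pullback_shear.
have H := is_deriveD (is_deriveZ k (dF u)) (dF h).
have -> : (fun s => pullback (shear s) w x (dfwith v i (k *: u + h))) =
   (k *: F u + F h).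
  by apply/funext => s; rewrite (pullback_multilinear (shear s) mw x).
by rewrite (@derive_val _ _ _ _ _ _ _ H) !derive_val.
Qed.

Lemma lie_derivative_shear_alternating p (w : dform E p) x : is_form w ->
  Defs.alternating (lie_derivative shear w x).
Proof.
move=> [_ aw _] v i j ij vij; rewrite /lie_derivative derive1E.
rewrite (_ : (fun s => _) = cst 0) ?derive_cst//; apply/funext => s.
exact: (pullback_alternating (shear s) aw x ij vij).
Qed.

(** The fundamental theorem of calculus: the integrand is, up to sign, the
    derivative in time of the pullback of [w] under the flow. *)
Lemma flow_integral_lie_derivative_shear p (w : dform E p) : is_form w ->
  flow_integral shear (lie_derivative shear w) =
  (-1) ^+ p *: (pullback (shear 1) w - w).
Proof.
move=> fw; apply/funext => x; apply/funext => v.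
rewrite flow_integralE; last 3 first.
- by move=> y; exact: lie_derivative_shear_multilinear.
- by move=> y; exact: lie_derivative_shear_alternating.
- exact: differentiable_shear_joint.
pose F s := (-1) ^+ p * pullback (shear s) w x v.
pose f s := (-1) ^+ p * pullback_shear_dot tau e c w s x v.
have dF (s : R) : is_derive s 1 F (f s).
  exact: (is_deriveZ ((-1) ^+ p) (is_derive_pullback_shear tau_cont e c s x v fw)).
have cF : continuous F.
  move=> s; apply: differentiable_continuous; apply/derivable1_diffP.
  by case: (dF s).
have cf : continuous f.
  suff : @Ck R R 0 (fun s => (-1) ^+ p * pullback_shear_dot tau e c w s x v) by [].
  apply: CkM; first exact: Ck_cst.
  exact: continuous_pullback_shear_dot.
under eq_Rintegral do rewrite pullback_lie_derivative_shear//.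
rewrite /Rintegral (@continuous_FTC2 _ f F)//.
- by rewrite -EFinB/= /F pullback_shear0//; exact: (esym (mulrBr _ _ _)).
- exact: continuous_subspaceT.
- split=> [s _||]; first by case: (dF s).
  + exact: (cvg_at_right_filter (cF 0)).
  + exact: (cvg_at_left_filter (cF 1)).
- by move=> s _; rewrite derive1E; exact: (@derive_val _ _ _ _ _ _ _ (dF s)).
Qed.

End FlowIntegralShear.

(** * Functions invariant under translations *)

Section Periods.
Context {R : realType}.
Implicit Types (g : R -> R) (d : R).

Definition period g d := forall x, g (x + d) = g x.

Lemma periodD g d d' : period g d -> period g d' -> period g (d + d').
Proof. by move=> pd pd' x; rewrite addrA pd' pd. Qed.

Lemma periodMz g d (k : int) : period g d -> period g (k%:~R * d).
Proof.
move=> pd.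
have pn n : period g (n%:R * d).
  elim: n => [|n IH] x; first by rewrite mul0r addr0.
  by rewrite -natr1 mulrDl mul1r addrA pd IH.
case: k => n; first exact: pn.
by move=> x; rewrite -(pn n.+1 (x + _)) NegzE mulrNz mulNr subrK.
Qed.

(** The positive periods either are arbitrarily small, which forces [g] to be
    constant, or are all multiples of the smallest one, which would make
    [theta] rational. *)
Lemma irrational_period_constant g (theta : R) : continuous g ->
  period g 1 -> period g theta -> irrational theta -> forall x y, g x = g y.
Proof.
move=> cg p1 pth irr.
pose S := [set d : R | 0 < d /\ period g d].
have S1 : S 1 by split.
have lbS : lbound S 0 by move=> d [/ltW].
have infS : has_inf S by split; [exists 1|exists 0].
have S0 : 0 <= inf S by apply: lb_le_inf; [exists 1|].
have mod_range d s : 0 < s -> 0 <= d - (Num.floor (d / s))%:~R * s < s.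
  move=> s0; have /andP[fl fu] := floor_itv (d / s); apply/andP; split.
  - by rewrite subr_ge0 -ler_pdivlMr.
  - by rewrite ltrBlDr -[X in _ < X + _]mul1r -mulrDl addrC -ltr_pdivrMr// -intrD1.
move: S0; rewrite le_eqVlt => /orP[/eqP S0|S0]; last first.
  have [s [s0 ps] ss] := inf_adherent (divr_gt0 S0 (ltr0Sn _ 1)) infS.
  have mult d : period g d -> d = (Num.floor (d / s))%:~R * s.
    move=> pd; have /andP[r0 rs] := mod_range d s s0.
    have pr : period g (d - (Num.floor (d / s))%:~R * s).
      by rewrite -mulNr -mulrNz; apply: periodD => //; exact: periodMz.
    apply/eqP; rewrite -subr_eq0; apply/eqP.
    move: r0 rs pr; set r := d - _ => r0 rs pr.
    apply/eqP; rewrite eq_le r0 andbT leNgt; apply/negP => r_gt0.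
    have lb : has_lbound S by exists 0.
    have h1 : inf S <= r by apply: (ge_inf lb); split.
    have h2 : inf S <= s - r.
      apply: (ge_inf lb); split; first by rewrite subr_gt0.
      apply: periodD => //; rewrite -[r]mul1r -mulNr -[- 1]/((-1)%:~R).
      exact: periodMz.
    by lra.
  exfalso; apply: irr.
  have e1 := mult 1 p1; have eth := mult theta pth.
  set n := Num.floor (1 / s) in e1; set m := Num.floor (theta / s) in eth.
  exists (m%:Q / n%:Q) => //; rewrite fmorph_div/= !ratr_int.
  have n0 : n%:~R != 0 :> R.
    by apply/eqP => n0; move: e1; rewrite n0 mul0r => /eqP; rewrite oner_eq0.
  apply: (@mulIf _ n%:~R n0).
  by rewrite divfK// eth -mulrA [s * _]mulrC -e1 mulr1.
move=> x y; apply/eqP; rewrite -subr_eq0 -normr_le0; apply/ler_addgt0Pl => e e0.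
rewrite addr0.
have /cvgrPdist_lt/(_ e e0)/nbhs_ballP[h /= h0 H] := cg y.
have [d [d0 pd] dh] := inf_adherent h0 infS.
rewrite -S0 add0r in dh.
have /andP[r0 rd] := mod_range (y - x) d d0.
have := H (x + (Num.floor ((y - x) / d))%:~R * d).
rewrite periodMz// distrC => {}H; apply/ltW/H.
rewrite /ball/= opprD addrA ger0_norm//.
exact: lt_trans dh.
Qed.

Lemma biperiodic_bounded (f : R * R -> R) : continuous f ->
  (forall x y, f (x + 1, y) = f (x, y)) -> (forall x y, f (x, y + 1) = f (x, y)) ->
  exists M, forall z, `|f z| <= M.
Proof.
move=> cf p1 p2.
have c2 : compact (`[0, 1] `*` `[0, 1] : set (R * R)).
  by apply: compact_setX; exact: segment_compact.
have n2 : (`[0, 1] `*` `[0, 1] : set (R * R)) !=set0.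
  by exists (0, 0); split; rewrite /= in_itv/= lexx ler01.
have cn : {within `[0, 1] `*` `[0, 1], continuous (fun z => `|f z|)}.
  apply: continuous_subspaceT => z; apply: continuous_comp; first exact: cf.
  exact: norm_continuous.
have [z _ zmax] := compact_EVT_max n2 c2 cn.
exists `|f z| => -[x y].
have q1 (k : int) x' y' : f (x' + k%:~R, y') = f (x', y').
  by rewrite -[k%:~R]mulr1; apply: (@periodMz (fun x => f (x, y'))) => ?; exact: p1.
have q2 (k : int) x' y' : f (x', y' + k%:~R) = f (x', y').
  by rewrite -[k%:~R]mulr1; apply: (@periodMz (fun y => f (x', y))) => ?; exact: p2.
rewrite -(q1 (- Num.floor x)) -(q2 (- Num.floor y)) !mulrNz; apply: zmax.
have fr (u : R) : u - (Num.floor u)%:~R \in `[0, 1].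
  have /andP[fl fu] := floor_itv u.
  rewrite in_itv/= subr_ge0 fl/= lerBlDr addrC; apply/ltW.
  by rewrite -intrD1.
by rewrite inE; split; exact: fr.
Qed.

(** As [t |-> lam ^ t] is a homeomorphism onto the positive reals, the [t] at which
    it takes a rational value are dense. *)
Lemma eq0_of_rational_powers (lam : R) (h : R -> R) : 0 < lam -> lam != 1 ->
  continuous h -> (forall t q, lam `^ t = ratr q -> h t = 0) -> forall t, h t = 0.
Proof.
move=> l0 l1 ch H t; apply/eqP; rewrite -normr_le0; apply/ler_addgt0Pl => e e0.
rewrite addr0.
have /cvgrPdist_lt/(_ e e0)/nbhs_ballP[d /= d0 Hd] := ch t.
have c0 : ln lam != 0.
  apply: contra l1 => /eqP c0; have lK : expR (ln lam) = lam by rewrite lnK// posrE.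
  by rewrite -lK c0 expR0.
suff [t' [q [/andP[t1 t2] Et']]] : exists t' q, t < t' < t + d /\ lam `^ t' = ratr q.
  rewrite -[h t]subr0 -(H _ _ Et'); apply/ltW/Hd.
  by rewrite /ball/= distrC gtr0_norm ?subr_gt0// ltrBlDl.
have E u : lam `^ u = expR (u * ln lam) by rewrite /powR gt_eqF.
have sol (r : R) : 0 < r -> lam `^ (ln r / ln lam) = r.
  by move=> r0; rewrite E divfK// lnK// posrE.
have [cp|cn] : 0 < ln lam \/ ln lam < 0 by case: (ltgtP (ln lam) 0) c0 => // ? _; [right|left].
- have : lam `^ t < lam `^ (t + d) by rewrite !E ltr_expR ltr_pM2r// ltrDl.
  move=> /rat_in_itvoo[q]; rewrite in_itv/= => /andP[q1 q2].
  have q0 : 0 < ratr q :> R by apply: lt_trans q1; rewrite powR_gt0.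
  exists (ln (ratr q) / ln lam), q; split; last exact: sol.
  move: q1 q2; rewrite -{1 2}(sol _ q0) !E !ltr_expR !ltr_pM2r// => -> ->.
  by [].
- have : lam `^ (t + d) < lam `^ t by rewrite !E ltr_expR ltr_nM2r// ltrDl.
  move=> /rat_in_itvoo[q]; rewrite in_itv/= => /andP[q1 q2].
  have q0 : 0 < ratr q :> R by apply: lt_trans q1; rewrite powR_gt0.
  exists (ln (ratr q) / ln lam), q; split; last exact: sol.
  by move: q1 q2; rewrite -{1 2}(sol _ q0) !E !ltr_expR !ltr_nM2r// => -> ->.
Qed.

Lemma irrationalMz (theta : R) (k : int) : k != 0 -> irrational theta ->
  irrational (k%:~R * theta).
Proof.
move=> k0 irr [q _ qE]; apply: irr; exists (q / k%:Q) => //.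
rewrite fmorph_div/= ratr_int qE mulrAC divff ?mul1r// intr_eq0//.
Qed.

(** Where [lam ^ t] is a rational number [m / n], the [n]-th iterate of the
    translation moves [x] by the integer [m] and [y] by the irrational number
    [m a]; one unit of [t] later it moves [x] by the irrational number
    [m lam]. *)
Lemma translation_invariant_fibrewise_constant (lam a : R) (f : R -> R -> R -> R) :
  0 < lam -> lam != 1 -> irrational lam -> irrational a ->
  (forall y t, continuous (fun x => f x y t)) ->
  (forall x t, continuous (fun y => f x y t)) ->
  (forall x y, continuous (f x y)) ->
  (forall x y t, f (x + 1) y t = f x y t) ->
  (forall x y t, f x (y + 1) t = f x y t) ->
  (forall x y t, f (x + lam `^ t) (y + lam `^ t * a) t = f x y t) ->
  forall x y x' y' t, f x y t = f x' y' t.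
Proof.
move=> l0 l1 lirr airr cx cy ct px py pl.
have pln (n : nat) x y t :
    f (x + n%:R * lam `^ t) (y + n%:R * (lam `^ t * a)) t = f x y t.
  elim: n => [|n IH]; first by rewrite !mul0r !addr0.
  by rewrite -natr1 !mulrDl !mul1r !addrA pl IH.
have pxz (k : int) x y t : f (x + k%:~R) y t = f x y t.
  by rewrite -[k%:~R]mulr1; apply: (@periodMz (fun x => f x y t)) => ?; exact: px.
have ratE t q : lam `^ t = ratr q -> exists (n : nat) (m : int),
    m != 0 /\ n%:R * lam `^ t = m%:~R.
  move=> tq; exists `|denq q|%N, (numq q); split.
    rewrite numq_eq0; apply/eqP => q0; have := powR_gt0 t l0.
    by rewrite tq q0 raddf0 ltxx.
  rewrite tq /ratr -[X in X * _]/((`|denq q|%N%:Z)%:~R) absz_denq mulrC divfK//.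
  by rewrite intr_eq0 denq_eq0.
have indep_y x y y' t : f x y t = f x y' t.
  apply/eqP; rewrite -subr_eq0; apply/eqP; move: t.
  apply: (eq0_of_rational_powers l0 l1).
    by move=> t; apply: continuousB; exact: ct.
  move=> t q /ratE[n [m [m0 nm]]]; apply/eqP; rewrite subr_eq0; apply/eqP.
  apply: (@irrational_period_constant (fun y => f x y t) (m%:~R * a)).
  - exact: cy.
  - by move=> z; exact: py.
  - move=> z; rewrite -[LHS](pxz m) -nm -mulrA pln//.
  - exact: irrationalMz.
have indep_x x x' y t : f x y t = f x' y t.
  rewrite -[t](subrK 1); apply/eqP; rewrite -subr_eq0; apply/eqP.
  move: (t - 1) => {}t; move: t.
  apply: (@eq0_of_rational_powers lam (fun t => f x y (t + 1) - f x' y (t + 1))) => //.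
    have ct1 z : continuous (fun t : R => f z y (t + 1)).
      move=> t; apply: (@continuous_comp _ _ _ (fun t : R => t + 1) (f z y)); last exact: ct.
      by apply: continuousD; [exact: cvg_id|exact: cst_continuous].
    by move=> t; apply: continuousB; exact: ct1.
  move=> t q /ratE[n [m [m0 nm]]]; apply/eqP; rewrite subr_eq0; apply/eqP.
  have lt1 : n%:R * lam `^ (t + 1) = m%:~R * lam.
    have -> : lam `^ (t + 1) = lam `^ t * lam.
      by rewrite powRD; [rewrite powRr1 ?ltW|rewrite (gt_eqF l0) implybT].
    by rewrite mulrA nm.
  apply: (@irrational_period_constant (fun x => f x y (t + 1)) (m%:~R * lam)).
  - exact: cx.
  - by move=> z; exact: px.
  - by move=> z; rewrite -lt1 -[RHS](pln n); exact: indep_y.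
  - exact: irrationalMz.
by move=> x y x' y' t; rewrite (indep_y x y y') (indep_x x x').
Qed.

End Periods.

(** * The hyperbolic matrix and the flow *)

Section MatrixContinuity.
Context {R : realType}.

Lemma continuous_pair (T U V : topologicalType) (f : T -> U) (g : T -> V) :
  continuous f -> continuous g -> continuous (fun z => (f z, g z)).
Proof. by move=> cf cg z; exact: (cvg_pair (cf z) (cg z)). Qed.

Lemma continuous_mx_entries (T : topologicalType) m n (f : T -> 'M[R]_(m, n)) :
  (forall i j, continuous (fun x => f x i j)) -> continuous f.
Proof.
move=> cf x; apply/cvgrPdist_le => /= d d0; near=> y.
rewrite [leLHS]/Num.Def.normr/= mx_normrE (bigmax_le _ (ltW d0))//= => i _.
rewrite !mxE/=; move: i; near: y; apply: filter_forall => /= i.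
exact: ((cvgrPdist_le _ _).1 (cf i.1 i.2 x)).
Unshelve. all: by end_near. Qed.

Lemma mulmx_continuous m n (B : 'M[R]_(m, n)) :
  continuous (fun x : 'cV[R]_n => B *m x).
Proof.
apply: continuous_mx_entries => i j.
under eq_fun do rewrite mxE.
suff : @Ck R _ 0 (fun x : 'cV[R]_n => \sum_k B i k * x k j) by [].
by apply: Ck_sum => k; apply: CkM; [exact: Ck_cst|exact: coord_continuous].
Qed.

Lemma vec2_continuous (T : topologicalType) (f g : T -> R) :
  continuous f -> continuous g -> continuous (fun z => vec2 (f z) (g z)).
Proof.
move=> cf cg; apply: continuous_mx_entries => i j.
under eq_fun do rewrite mxE.
by case: (i == ord0).
Qed.

Lemma is_derive_linear (U V : normedModType R) (l : {linear U -> V}) (f : R -> U)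
    (s : R) df : continuous l -> is_derive s 1 f df -> is_derive s 1 (fun r => l (f r)) (l df).
Proof.
move=> cl dfs.
have d1 : differentiable f s by apply/derivable1_diffP; case: dfs.
have d2 : differentiable l (f s) by exact: linear_differentiable.
have d3 : differentiable (l \o f) s by exact: differentiable_comp.
apply: DeriveDef; first exact/derivable1_diffP.
rewrite (deriveE _ d3) (diff_comp d1 d2) /= (diff_lin _ cl) -deriveE//.
by rewrite derive_val.
Qed.

Lemma vec2_eta (u : 'cV[R]_2) : u = vec2 (u ord0 ord0) (u (lift ord0 ord0) ord0).
Proof.
apply/matrixP => i j; rewrite mxE !ord1; case: (unliftP ord0 i) => [k ->|->] //=.
by rewrite ord1.
Qed.

Lemma vec2D (x y x' y' : R) : vec2 x y + vec2 x' y' = vec2 (x + x') (y + y').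
Proof. by apply/matrixP => i j; rewrite !mxE; case: ifP. Qed.

Lemma vec2Z (c x y : R) : c *: vec2 x y = vec2 (c * x) (c * y).
Proof. by apply/matrixP => i j; rewrite !mxE; case: ifP. Qed.

End MatrixContinuity.

Section HyperbolicMatrix.
Context {R : realType} {A : 'M[int]_2} {P : 'M[R]_2} {lam a : R}.
Hypotheses (P_unit : P \in unitmx) (lam_gt0 : 0 < lam) (lam_neq1 : lam != 1)
  (A_diag : map_mx intr A = P *m diag2 lam lam^-1 *m invmx P)
  (lam_irr : irrational lam)
  (eigen_a : map_mx intr A *m vec2 1 a = lam *: vec2 1 a).

(** The eigenvalues being distinct, [invmx P] maps the eigenvector to the first
    axis, on which [D^t] is the multiplication by [lam ^ t]. *)
Lemma mxpow_eigenvector t : mxpow P lam t *m vec2 1 a = lam `^ t *: vec2 1 a.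
Proof.
pose u := invmx P *m vec2 1 a.
have uE : vec2 1 a = P *m u by rewrite /u mulmxA mulmxV// mul1mx.
have Du : diag2 lam lam^-1 *m u = lam *: u.
  apply: (can_inj (mulKmx P_unit)).
  by rewrite -scalemxAr -uE -eigen_a A_diag /u !mulmxA.
have u1 : u (lift ord0 ord0) ord0 = 0.
  have := congr1 (fun w : 'cV[R]_2 => w (lift ord0 ord0) ord0) Du.
  rewrite mul_diag_mx !mxE /= => /eqP; rewrite -subr_eq0 -mulrBl mulf_eq0.
  move=> /orP[|/eqP//]; rewrite subr_eq0 => /eqP E.
  have : lam ^+ 2 = 1 by rewrite expr2 -{1}E mulVf// gt_eqF.
  move=> /eqP; rewrite sqrf_eq1 (negbTE lam_neq1)/= => /eqP E1.
  by move: lam_gt0; rewrite E1 ltr0N1.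
rewrite /mxpow -!mulmxA -/u; move: u uE {Du} u1 => u uE u1.
have -> : diag2 (lam `^ t) (lam `^ (- t)) *m u = lam `^ t *: u.
  rewrite mul_diag_mx; apply/matrixP => i j; rewrite !mxE ord1.
  case: (unliftP ord0 i) => [k ->|->] //=.
  by rewrite [k]ord1 u1 !mulr0.
by rewrite -scalemxAr -uE.
Qed.

Lemma mxpow0 : mxpow P lam 0 = 1%:M.
Proof.
rewrite /mxpow oppr0 powRr0 (_ : diag2 1 1 = 1%:M) ?mulmx1 ?mulmxV//.
by apply/matrixP => i j; rewrite !mxE; case: ifP.
Qed.

(** The first line of the eigenvector equation writes [lam] as a combination of
    [1] and [a] with integer coefficients. *)
Lemma eigenvector_slope_irrational : irrational a.
Proof.
move=> [q _ qE]; apply: lam_irr.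
have := congr1 (fun w : 'cV[R]_2 => w ord0 ord0) eigen_a.
rewrite !mxE /= big_ord_recl big_ord1 !mxE/= !mulr1 -qE => E.
exists ((A ord0 ord0)%:Q + (A ord0 (lift ord0 ord0))%:Q * q) => //.
by rewrite rmorphD rmorphM/= !ratr_int.
Qed.

End HyperbolicMatrix.

Section Torus.
Context {R : realType}.

Definition time_coord : {linear G3 R -> R} := snd.

Lemma time_coord_continuous : continuous time_coord.
Proof. by move=> x; exact: cvg_snd. Qed.

Lemma powR_exp (lam t : R) : 0 < lam -> lam `^ t = expR (ln lam * t).
Proof. by move=> l0; rewrite /powR gt_eqF// mulrC. Qed.

Lemma shear_timeE (lam a s : R) (x : G3 R) : 0 < lam ->
  shear time_coord (vec2 1 a, 0) (ln lam) s x = (x.1 + (s * lam `^ x.2) *: vec2 1 a, x.2).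
Proof.
by move=> l0; rewrite /shear /shear_speed -powR_exp//; congr pair; rewrite /= scaler0 addr0.
Qed.

(** Along a solution the last coordinate is constant, so that the velocity is
    constant. *)
Lemma torus_flowE (lam a : R) (phi : R -> G3 R -> G3 R) : 0 < lam ->
  is_flow (torus_field lam a) phi -> phi = shear time_coord (vec2 1 a, 0) (ln lam).
Proof.
move=> l0 [phi0 dphi]; apply/funext => s; apply/funext => x; rewrite shear_timeE//.
have phi2 r : (phi r x).2 = x.2.
  rewrite -[in RHS](phi0 x); apply: (@is_derive_0_is_cst R (fun r => (phi r x).2)) => r'.
  exact: (is_derive_linear time_coord_continuous (dphi x r')).
have phi1 r : (phi r x).1 = x.1 + (r * lam `^ x.2) *: vec2 1 a.
  have d1 r' : is_derive r' (1 : R) (fun r => (phi r x).1) (lam `^ x.2 *: vec2 1 a).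
    have cfst : continuous (fst : G3 R -> 'cV[R]_2) by move=> ?; exact: cvg_fst.
    have := @is_derive_linear R _ _ fst (fun r => phi r x) r' _ cfst (dphi x r').
    by rewrite /= phi2.
  apply/matrixP => i j.
  pose h r := (phi r x).1 i j - r * (lam `^ x.2 * vec2 1 a i j).
  have dh r' : is_derive r' (1 : R) h 0.
    have [e1 e2] := d1 r'.
    have e3 : is_derive r' (1 : R) (fun r => (phi r x).1 i j) (lam `^ x.2 * vec2 1 a i j).
      apply: DeriveDef; first exact: (derivable_mxP _ _ _).1 e1 i j.
      have := congr1 (fun M : 'cV[R]_2 => M i j) (derive_mx e1).
      by rewrite e2 !mxE => <-.
    have H := is_deriveB e3 (is_deriveM (is_derive_id r' 1)
      (is_derive_cst (lam `^ x.2 * vec2 1 a i j) r' 1)).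
    apply: (is_derive_eq H).
    by rewrite scaler0 add0r -[_ *: _]/(_ * _) mulr1 subrr.
  have := @is_derive_0_is_cst R h r 0 dh.
  rewrite /h mul0r subr0 phi0 => /eqP; rewrite subr_eq => /eqP ->.
  by rewrite !mxE mulrA.
by rewrite [LHS]surjective_pairing phi1 phi2.
Qed.

End Torus.

(** * Forms on the torus *)

Section TorusForms.
Context {R : realType} (P : 'M[R]_2) (lam a : R).
Hypotheses (P_unit : P \in unitmx) (lam_gt0 : 0 < lam) (lam_neq1 : lam != 1)
  (lam_irr : irrational lam) (a_irr : irrational a)
  (eigen_mxpow : forall t, mxpow P lam t *m vec2 1 a = lam `^ t *: vec2 1 a).

Local Notation Omega := (torus_forms P lam).
Local Notation dir := ((vec2 1 a, 0) : G3 R).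
Local Notation flow := (shear time_coord dir (ln lam)).
Local Notation speed := (shear_speed time_coord (ln lam)).
Local Notation tcont := (@time_coord_continuous R).

Lemma time_coord_dir : time_coord dir = 0.
Proof. by []. Qed.

Lemma is_diff_G3_mul g x :
  is_diff x (G3_mul P lam g : G3 R -> G3 R) (fun v => (mxpow P lam g.2 *m v.1, v.2)).
Proof.
have c1 : continuous (fst : G3 R -> 'cV[R]_2) by move=> ?; exact: cvg_fst.
have d1 : is_diff x (fun y : G3 R => mxpow P lam g.2 *m y.1) (fun v => mxpow P lam g.2 *m v.1).
  have dm : is_diff (x.1) (mulmx (mxpow P lam g.2) : 'cV[R]_2 -> 'cV[R]_2)
      (mulmx (mxpow P lam g.2)).
    have cm := @mulmx_continuous R _ _ (mxpow P lam g.2).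
    by apply: DiffDef; [exact: linear_differentiable|exact: diff_lin].
  have df : is_diff x (fst : G3 R -> 'cV[R]_2) fst.
    by apply: DiffDef; [exact: linear_differentiable|exact: diff_lin].
  exact: (is_diff_comp df dm).
have d2 : is_diff x (fun y : G3 R => y.2) (fun v => v.2) := is_diff_tau tcont x.
have H := is_diff_pair (is_diffD (is_diff_cst g.1 x) d1) (is_diffD (is_diff_cst g.2 x) d2).
apply: (is_diff_eq H).
by apply/funext => v; rewrite /= !fctE !add0r.
Qed.

Lemma differentiable_G3_mul g (x : G3 R) : differentiable (G3_mul P lam g) x.
Proof. by case: (is_diff_G3_mul g x). Qed.

(** Left invariance of the field: by the eigenvector equation the matrix in the
    group law multiplies the field by [lam ^ g.2], which is also the ratio of its
    values at heights differing by [g.2]. *)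
Lemma flow_G3_mul s g : flow s \o G3_mul P lam g = G3_mul P lam g \o flow s.
Proof.
apply/funext => x; rewrite /= !shear_timeE//=; congr pair => /=.
rewrite mulmxDr -scalemxAr eigen_mxpow scalerA -addrA -mulrA [lam `^ x.2 * _]mulrC.
by rewrite powRD// (gt_eqF lam_gt0) implybT.
Qed.

Section Degree.
Context {p : nat}.
Implicit Types (w h : dform (G3 R) p).

Lemma torus_form_is_form w : Omega w -> is_form w.
Proof. by case. Qed.

Lemma torus_form_comb c w h : Omega w -> Omega h -> Omega (c *: w + h).
Proof.
move=> [fw iw] [fh ih]; split; first exact: is_form_comb.
by move=> g Gg; rewrite -[in RHS](iw g Gg) -[in RHS](ih g Gg).
Qed.

Lemma torus_form0 : Omega (0 : dform (G3 R) p).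
Proof.
have E x v : (0 : dform (G3 R) p) x v = 0 by [].
split=> //; split=> [x v i c u h|//|v].
- by rewrite !E mulr0 addr0.
- exact: smooth_cst.
Qed.

Lemma torus_form_pullback s w : Omega w -> Omega (pullback (flow s) w).
Proof.
move=> [fw iw]; split; first exact: (pullback_shear_form tcont).
move=> g Gg; have dG y : differentiable (G3_mul P lam g) y by exact: differentiable_G3_mul.
have dS y : differentiable (flow s) y by exact: (differentiable_shear tcont).
rewrite (pullback_comp w dG dS) (flow_G3_mul s g).
by rewrite -(pullback_comp w dS dG) (iw g Gg).
Qed.

Lemma torus_form_d w : Omega w -> Omega (exterior_d w).
Proof.
move=> [fw iw]; split; first exact: exterior_d_form.
move=> g Gg.
by rewrite (exterior_d_pullback_affine fw (is_diff_G3_mul g)) iw.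
Qed.

(** The elements of the lattice with last coordinate [0] act as translations by
    integer vectors, whose differential is the identity. *)
Lemma torus_form_periodic w (m1 m2 : int) u t v : Omega w ->
  w (u + vec2 m1%:~R m2%:~R, t) v = w (u, t) v.
Proof.
move=> [fw iw].
pose m : 'cV[int]_2 := \col_i (if i == ord0 then m1 else m2).
pose g : G3 R := (map_mx intr m, 0).
have Gg : Gamma3 g by exists (m, 0).
have mE : map_mx intr m = vec2 m1%:~R m2%:~R :> 'cV[R]_2.
  by apply/matrixP => i j; rewrite !mxE; case: ifP.
rewrite -[in RHS](iw g Gg) /pullback.
have -> : G3_mul P lam g (u, t) = (u + vec2 m1%:~R m2%:~R, t).
  by rewrite /G3_mul /g /= mxpow0// mul1mx add0r mE addrC.
congr (w _); apply/funext => i.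
rewrite (@diff_val _ _ _ _ _ _ _ (is_diff_G3_mul g (u, t))) /g/= mxpow0// mul1mx.
by rewrite -surjective_pairing.
Qed.

Lemma torus_form_continuous w v : Omega w -> continuous (fun y => w y v).
Proof. by move=> [[_ _ sw] _]; apply: smooth_continuous. Qed.

Lemma torus_form_bounded_fibre w v t : Omega w ->
  exists M, forall u, `|w (u, t) v| <= M.
Proof.
move=> Ow.
have c1 : continuous (fun z : R * R => (vec2 z.1 z.2, t) : G3 R).
  apply: continuous_pair; last by move=> ?; exact: cvg_cst.
  by apply: vec2_continuous => ?; [exact: cvg_fst|exact: cvg_snd].
have [M HM] : exists M, forall z : R * R, `|w (vec2 z.1 z.2, t) v| <= M.
  apply: biperiodic_bounded.
  - move=> z; apply: (@continuous_comp _ _ _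
      (fun z : R * R => (vec2 z.1 z.2, t) : G3 R) (fun y => w y v)).
      exact: c1.
    exact: (@torus_form_continuous w v Ow).
  - by move=> x y; rewrite /= -[RHS](torus_form_periodic 1 0 _ _ _ Ow) vec2D addr0.
  - by move=> x y; rewrite /= -[RHS](torus_form_periodic 0 1 _ _ _ Ow) vec2D addr0.
by exists M => u; rewrite (vec2_eta u); exact: (HM (_, _)).
Qed.

(** The flow preserves the fibres of the last coordinate, on which a coefficient
    invariant under [flow 1] is constant. *)
Lemma flow_invariant_coefficient w v : Omega w ->
  (forall x, w (flow 1 x) v = w x v) -> forall s x, w (flow s x) v = w x v.
Proof.
move=> Ow inv s [u t]; rewrite shear_timeE//= (vec2_eta u) vec2Z vec2D.
pose f x y t := w (vec2 x y, t) v.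
have pcont (c1 : R -> R) (c2 : R -> R) (c3 : R -> R) : continuous c1 -> continuous c2 ->
    continuous c3 -> continuous (fun r => f (c1 r) (c2 r) (c3 r)).
  move=> h1 h2 h3 r.
  apply: (@continuous_comp _ _ _ (fun r => (vec2 (c1 r) (c2 r), c3 r) : G3 R) (fun y => w y v)).
    by apply: continuous_pair; [exact: vec2_continuous|].
  exact: (@torus_form_continuous w v Ow).
have cc (k : R) : continuous (fun _ : R => k) by move=> ?; exact: cvg_cst.
have ci : continuous (fun r : R => r) by move=> ?; exact: cvg_id.
apply: (@translation_invariant_fibrewise_constant R lam a f) => //.
- by move=> y t'; exact: pcont.
- by move=> x t'; exact: pcont.
- by move=> x y; exact: pcont.
- by move=> x y t'; rewrite /f -[RHS](torus_form_periodic 1 0 _ _ _ Ow) vec2D addr0.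
- by move=> x y t'; rewrite /f -[RHS](torus_form_periodic 0 1 _ _ _ Ow) vec2D addr0.
- move=> x y t'; rewrite /f -[RHS]inv shear_timeE//= mul1r vec2Z vec2D mulr1//.
Qed.

(** The coefficients of a form fixed by [flow 1] change linearly along the
    orbits of [flow 1]. Being bounded on each fibre they are constant on these
    orbits, hence on the fibre, and then the form is fixed by the whole flow. *)
Lemma flow_invariant_form w : Omega w -> pullback (flow 1) w = w ->
  forall s, pullback (flow s) w = w.
Proof.
move=> Ow inv; have fw := torus_form_is_form Ow.
have invn (n : nat) : pullback (flow n%:R) w = w.
  elim: n => [|n IH]; first exact: (pullback_shear0 tcont).
  by rewrite -natr1 -(pullback_shear_comp tcont (ln lam) time_coord_dir) inv.
have invN (n : nat) : pullback (flow (- n%:R)) w = w.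
  rewrite -[in LHS](invn n) (pullback_shear_comp tcont (ln lam) time_coord_dir) addNr.
  exact: (pullback_shear0 tcont).
pose K v x := \sum_j ln lam * time_coord (v j) * speed x * w x (dfwith v j dir).
have KE (s : R) v x y : speed x = speed y ->
    (\sum_j s * (ln lam * time_coord (v j) * speed x) * w y (dfwith v j dir)) = s * K v y.
  by move=> E; rewrite mulr_sumr; apply: eq_bigr => j _; rewrite E !mulrA.
have speedE s x : speed (flow s x) = speed x.
  exact: shear_speed_shift.
have flowN s x : flow (- s) (flow s x) = x.
  have := congr1 (fun h : G3 R -> G3 R => h x) (shear_comp (ln lam) time_coord_dir (- s) s).
  by rewrite /= subrr shear0.
have lin (n : nat) v x : w (flow n%:R x) v = w x v - n%:R * K v x.
  rewrite -[in LHS](invN n) (pullback_shearE tcont)// flowN KE ?mulNr//.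
have K0 v x : K v x = 0.
  have [M HM] := torus_form_bounded_fibre v x.2 Ow.
  apply/eqP; rewrite -normr_le0 leNgt; apply/negP => K_gt0.
  (* an iterate at which the affine growth exceeds the bound *)
  pose n := (Num.truncn ((M + `|w x v|) / `|K v x|)).+1.
  have : n%:R * `|K v x| <= M + `|w x v|.
    have -> : n%:R * `|K v x| = `|w x v - w (flow n%:R x) v|.
      by rewrite lin opprB addrC subrK normrM normr_nat.
    rewrite [M + _]addrC (le_trans (ler_normB _ _))// lerD2l.
    by rewrite shear_timeE//; exact: HM.
  rewrite -ler_pdivlMr// leNgt => /negP; apply.
  exact: truncnS_gt.
have const v s x : w (flow s x) v = w x v.
  apply: flow_invariant_coefficient => // y.
  by have := lin 1 v y; rewrite K0 mulr0 subr0.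
move=> s; apply/funext => x; apply/funext => v.
by rewrite (pullback_shearE tcont)// const KE ?K0 ?mulr0 ?addr0// speedE.
Qed.

Lemma lie_derivative_comb c w h : Omega w -> Omega h ->
  lie_derivative flow (c *: w + h) = c *: lie_derivative flow w + lie_derivative flow h.
Proof.
move=> [fw _] [fh _]; apply/funext => x; apply/funext => v.
rewrite /lie_derivative !fctE !derive1E.
have d1 := is_derive_pullback_shear tcont dir (ln lam) 0 x v fw.
have d2 := is_derive_pullback_shear tcont dir (ln lam) 0 x v fh.
have H := is_deriveD (is_deriveZ c d1) d2.
rewrite [LHS](@derive_val _ _ _ _ _ _ _ H).
by rewrite (@derive_val _ _ _ _ _ _ _ d1) (@derive_val _ _ _ _ _ _ _ d2).
Qed.

Lemma lie_derivative_invariant w : (forall s, pullback (flow s) w = w) ->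
  lie_derivative flow w = 0.
Proof.
move=> inv; apply/funext => x; apply/funext => v.
by rewrite /lie_derivative; under eq_fun do rewrite inv; rewrite derive1_cst.
Qed.

(** The difference between [w] and its pullback at time [n] telescopes into
    differences at time [1], and for negative [n] it is, up to sign, the difference
    at time [- n] of the pullback of [w]. So the coinvariant forms are the values
    of the fibre integral on the Lie derivatives. *)
Lemma coinvariant_formsP (k : dform (G3 R) p) :
  coinvariant_forms Omega (fun n : int => flow n%:~R) k <->
  exists2 w, Omega w & k = pullback (flow 1) w - w.
Proof.
split; last first.
  move=> [w Ow ->]; exists 1%N, (fun=> -1), (fun=> w - pullback (flow 1) w).
  split; first by move=> _; exists 1, w.
  by rewrite big_ord1 scaleN1r opprB.
pose B (k : dform (G3 R) p) := exists2 w, Omega w & k = pullback (flow 1) w - w.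
have Bcomb c k1 k2 : B k1 -> B k2 -> B (c *: k1 + k2).
  move=> [w1 O1 ->] [w2 O2 ->]; exists (c *: w1 + w2); first exact: torus_form_comb.
  by rewrite -[pullback _ (_ + _)]/(c *: pullback _ w1 + pullback _ w2) scalerBr addrACA opprD.
have B0 : B 0 by exists 0; [exact: torus_form0|rewrite subr0].
have Bn (n : nat) w : Omega w -> B (w - pullback (flow n%:R) w).
  move=> Ow; elim: n => [|n IH].
    by rewrite (pullback_shear0 tcont) subrr.
  have -> : w - pullback (flow n.+1%:R) w =
     (-1) *: (pullback (flow 1) (pullback (flow n%:R) w) - pullback (flow n%:R) w)
      + (w - pullback (flow n%:R) w).
    rewrite (pullback_shear_comp tcont (ln lam) time_coord_dir) nat1r scaleN1r opprB.
    move: (pullback (flow n.+1%:R) w) (pullback (flow n%:R) w) => z u.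
    by rewrite [RHS]addrC addrA subrK.
  apply: Bcomb => //; exists (pullback (flow n%:R) w) => //.
  exact: torus_form_pullback.
have Bz (n : int) w : Omega w -> B (w - pullback (flow n%:~R) w).
  move=> Ow; case: n => n; first exact: Bn.
  have Ow' := torus_form_pullback (Negz n)%:~R Ow.
  have E : pullback (flow n.+1%:R) (pullback (flow (Negz n)%:~R) w) = w.
    rewrite (pullback_shear_comp tcont (ln lam) time_coord_dir).
    have -> : n.+1%:R + (Negz n)%:~R = 0 :> R by rewrite NegzE mulrNz subrr.
    exact: (pullback_shear0 tcont).
  have := Bn n.+1 _ Ow'; rewrite E => /(Bcomb (-1) _ 0) /(_ B0).
  by rewrite scaleN1r opprB addr0.
move=> [n [c [f [Hf ->]]]].
elim: n c f Hf => [|n IH] c f Hf; first by rewrite big_ord0.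
rewrite big_ord_recl; apply: Bcomb; last by apply: IH => i; exact: Hf.
by have [m [w [Ow ->]]] := Hf ord0; exact: Bz.
Qed.

End Degree.
End TorusForms.

(** * The isomorphism *)

Theorem theorem3p0p1 (R : realType) (A : 'M[int]_2) (P : 'M[R]_2) (lam a : R)
    (phi : R -> G3 R -> G3 R)
    (detA : \det A = 1) (trA : 2 < \tr A)
    (P_unit : P \in unitmx) (lam_gt0 : 0 < lam) (lam_neq1 : lam != 1)
    (A_diag : map_mx intr A = P *m diag2 lam lam^-1 *m invmx P)
    (lam_irr : irrational lam)
    (eigen_a : map_mx intr A *m vec2 1 a = lam *: vec2 1 a)
    (flow_phi : is_flow (torus_field lam a) phi) :
  anti_complex_iso
    (divergence_forms (torus_forms P lam) phi)
    (coinvariant_forms (torus_forms P lam) (fun n : int => phi n%:~R))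
    (fun p => @flow_integral R (G3 R) p phi).
Proof.
have eigen_mxpow := mxpow_eigenvector P_unit lam_gt0 lam_neq1 A_diag eigen_a.
have a_irr := eigenvector_slope_irrational lam_irr eigen_a.
have -> := torus_flowE lam_gt0 flow_phi.
have tcont := @time_coord_continuous R; have te := @time_coord_dir R a.
set flow := shear _ _ _; set Omega := torus_forms P lam.
have Oform p w : Omega p w -> is_form w by case.
have coinvP p (k : dform (G3 R) p) :
    coinvariant_forms Omega (fun n : int => flow n%:~R) k <->
    exists2 w, Omega p w & k = pullback (flow 1) w - w.
  exact: coinvariant_formsP.
have IE p (w : dform (G3 R) p) : Omega p w -> flow_integral flow (lie_derivative flow w) =
    (-1) ^+ p *: (pullback (flow 1) w - w).
  by move=> /Oform fw; exact: flow_integral_lie_derivative_shear.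
have Od p (w : dform (G3 R) p) : Omega p w -> Omega p.+1 (exterior_d w).
  exact: torus_form_d.
have Ocomb p c (w h : dform (G3 R) p) : Omega p w -> Omega p h -> Omega p (c *: w + h).
  exact: torus_form_comb.
have OZ p c (w : dform (G3 R) p) : Omega p w -> Omega p (c *: w).
  by move=> Ow; have := Ocomb p c w 0 Ow (torus_form0 _ _); rewrite addr0.
have Lcomb p c (w h : dform (G3 R) p) : Omega p w -> Omega p h ->
    lie_derivative flow (c *: w + h) = c *: lie_derivative flow w + lie_derivative flow h.
  exact: lie_derivative_comb.
have dL p (w : dform (G3 R) p) : Omega p w ->
    exterior_d (lie_derivative flow w) = lie_derivative flow (exterior_d w).
  by move=> /Oform fw; exact: exterior_d_lie_derivative_shear.
have dD p (w : dform (G3 R) p) : Omega p w ->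
    exterior_d (pullback (flow 1) w - w) = pullback (flow 1) (exterior_d w) - exterior_d w.
  move=> Ow; have Ow1 : is_form (pullback (flow 1) w).
    by apply: pullback_shear_form => //; exact: Oform.
  rewrite addrC -scaleN1r exterior_d_comb//; last exact: Oform.
  rewrite scaleN1r addrC exterior_d_pullback_shear//; exact: Oform.
split.
- move=> p _ [w Ow <-]; rewrite dL//; exists (exterior_d w) => //; exact: Od.
- move=> p k /coinvP[w Ow ->]; rewrite dD//.
  by apply/coinvP; exists (exterior_d w) => //; exact: Od.
- move=> p c _ _ [w Ow <-] [h Oh <-].
  rewrite -Lcomb// !IE//; last exact: Ocomb.
  rewrite scalerA mulrC -scalerA -scalerDr; congr (_ *: _).
  rewrite -[pullback _ (_ + _)]/(c *: pullback (flow 1) w + pullback (flow 1) h).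
  by rewrite scalerBr addrACA opprD.
- move=> p _ [w Ow <-]; rewrite dL// !IE//; last exact: Od.
  rewrite -dD// exprS mulN1r scaleNr exterior_dZ//.
  rewrite addrC -scaleN1r; apply: is_form_comb; first exact: Oform.
  by apply: pullback_shear_form => //; exact: Oform.
- move=> p; split.
  + move=> _ [w Ow <-]; rewrite IE//; apply/coinvP.
    exists ((-1) ^+ p *: w).
      exact: OZ.
    by rewrite scalerBr.
  + move=> _ _ /set_mem[w1 O1 <-] /set_mem[w2 O2 <-].
    rewrite !IE// => /scalerI E.
    have {}E : pullback (flow 1) w1 - w1 = pullback (flow 1) w2 - w2.
      by apply: E; rewrite signr_eq0.
    pose u := (-1) *: w2 + w1.
    have Ou : Omega p u by exact: Ocomb.
    have inv : pullback (flow 1) u = u.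
      rewrite /u -[LHS]/((-1) *: pullback (flow 1) w2 + pullback (flow 1) w1).
      have -> : pullback (flow 1) w1 = (pullback (flow 1) w2 - w2) + w1 by rewrite -E subrK.
      by rewrite !scaleN1r -addrA addKr.
    have := lie_derivative_invariant
      (flow_invariant_form P_unit lam_gt0 lam_neq1 lam_irr a_irr Ou inv).
    rewrite Lcomb// scaleN1r => /eqP.
    by rewrite addrC subr_eq0 => /eqP.
  + move=> k /coinvP[w Ow ->].
    exists (lie_derivative flow ((-1) ^+ p *: w)).
      by exists ((-1) ^+ p *: w) => //; exact: OZ.
    rewrite IE; last by apply: OZ.
    rewrite -[pullback _ (_ *: _)]/((-1) ^+ p *: pullback (flow 1) w) -scalerBr scalerA.
    by rewrite -expr2 sqrr_sign scale1r.
Qed.
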